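(* Let $B$ be a brick (over $\Lambda$). The following are equivalent: (1) The vector $\dim B$ in $V$ is a real root. (2) We have $(\dim B,\dim B)>0$. (3) The brick $B$ is rigid, meaning that $\mathrm{Ext}^1_{\Lambda}(B,B)=0$.
   Context: Root system. Let $d_1,\dots,d_n$ be positive integers and let $A=(A_{ij})$ be an $n\times n$ integer matrix with $A_{ii}=2$, $d_iA_{ij}=d_jA_{ji}$, and $A_{ij}\le 0$ for $i\ne j$ (a crystallographic symmetrizable Cartan matrix). Let $V$ be the real vector space with basis $\alpha_1,\dots,\alpha_n$, with symmetric bilinear form $(\alpha_i,\alpha_j)=d_iA_{ij}$; put $\alpha_i^\vee=d_i^{-1}\alpha_i$ and $s_i(x)=x-(\alpha_i^\vee,x)\alpha_i$. Let $W\subset \mathrm{GL}(V)$ be generated by the $s_i$. The set of real roots is $\Phi=\{w\alpha_i: w\in W,\ 1\le i\le n\}$. Preprojective algebra. Put $d_{ij}=\mathrm{LCM}(d_i,d_j)$, $L=\mathrm{LCM}(d_1,\dots,d_n)$. Let $\kappa(L)/\kappa$ be a Galois extension of fields with cyclic Galois group of order $L$, and for $d\mid L$ let $\kappa(d)$ be the unique subextension of degree $d$ over $\kappa$. Let $\Gamma$ be the quiver with vertices $1,\dots,n$ and, for $i\neq j$, $-d_iA_{ij}/d_{ij}$ arrows $i\to j$; fix a bijection $a\mapsto a^*$ between arrows $i\to j$ and arrows $j\to i$ with $(a^* )^*=a$. Let $E(j\leftarrow i)$ be the $\kappa(d_{ij})$-vector space with basis the arrows $i\to j$, regarded as a $\kappa(d_j)$-$\kappa(d_i)$-bimodule.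 The path algebra is the tensor algebra over $\prod_i\kappa(d_i)$ of the bimodule $\bigoplus_{i\ne j}E(j\leftarrow i)$. For $i\ne j$ let $(b^{ji}_k)_k$ be a $\kappa(d_j)$-basis of $\kappa(d_{ij})$ and $((b^{ji}_k)^* )_k$ the dual basis for the trace pairing $(b,b')\mapsto\mathrm{tr}_{\kappa(d_{ij})/\kappa(d_j)}(bb')$. Fix signs $\mathrm{sgn}(i,j)\in\{\pm1\}$ for $i\ne j$ with $\mathrm{sgn}(i,j)=-\mathrm{sgn}(j,i)$. The preprojective algebra $\Lambda$ is the quotient of the path algebra by the relations $\sum_{j\ne i}\mathrm{sgn}(i,j)\sum_{a:i\to j}\sum_k (b^{ji}_k)^*a^*\otimes a\,b^{ji}_k=0$ for $1\le i\le n$ (up to isomorphism independent of the choices). A $\Lambda$-module $M$ (left module) is a collection of $\kappa(d_i)$-vector spaces $M_i$ with $\kappa(d_j)$-linear maps $E(j\leftarrow i)\otimes_{\kappa(d_i)}M_i\to M_j$ satisfying these relations; $M$ is finite dimensional if all $M_i$ are finite dimensional over $\kappa$, and then $\dim M=\sum_i(\dim_{\kappa(d_i)}M_i)\alpha_i\in V$. A brick is a nonzero finite dimensional $\Lambda$-module whose endomorphism ring is a division ring. *)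

(* Defs.v *)
From HB Require Import structures.
From mathcomp Require Import all_boot all_order all_algebra.
From mathcomp Require Import all_fingroup all_solvable all_field.
From mathcomp Require Import reals.

Set Implicit Arguments.
Unset Strict Implicit.
Unset Printing Implicit Defensive.

Import Order.TTheory GRing.Theory Num.Theory.
Local Open Scope ring_scope.

Record cartanDatum (n : nat) := CartanDatum {
  cd_d : 'I_n -> nat;
  cd_A : 'M[int]_n;
  cd_d_gt0 : forall i, (0 < cd_d i)%N;
  cd_diag : forall i, cd_A i i = 2;
  cd_sym : forall i j, (cd_d i)%:Z * cd_A i j = (cd_d j)%:Z * cd_A j i;
  cd_offdiag : forall i j, i != j -> cd_A i j <= 0
}.

Section RootSystem.
Variables (R : realType) (n : nat) (C : cartanDatum n).
Implicit Types x y : 'rV[R]_n.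

Definition sroot (i : 'I_n) : 'rV[R]_n := delta_mx 0 i.

Definition scoroot (i : 'I_n) : 'rV[R]_n := (cd_d C i)%:R^-1 *: sroot i.

Definition cform x y : R :=
  \sum_i \sum_j x 0 i * y 0 j * ((cd_d C i)%:Z * cd_A C i j)%:~R.

Definition srefl (i : 'I_n) x : 'rV[R]_n := x - cform (scoroot i) x *: sroot i.

Fact srefl_is_linear i : linear (srefl i).
Proof.
move=> a x y; rewrite /srefl.
have -> : cform (scoroot i) (a *: x + y)
          = a * cform (scoroot i) x + cform (scoroot i) y.
  rewrite /cform mulr_sumr -big_split; apply: eq_bigr => k _ /=.
  rewrite mulr_sumr -big_split; apply: eq_bigr => l _ /=.
  by rewrite !mxE mulrDr mulrDl !mulrA [_ * a]mulrC !mulrA.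
by rewrite scalerDl -scalerA opprD scalerBr addrACA.
Qed.
HB.instance Definition _ i :=
  GRing.isLinear.Build R 'rV[R]_n 'rV[R]_n *:%R (srefl i) (srefl_is_linear i).

(* The subgroup W of GL(V) generated by the simple reflections.  On bijective
   endomorphisms (the only ones occurring here) the operation ^-1%VF, which in
   general is a one-sided inverse, is the two-sided inverse. *)
Inductive weyl : 'End('rV[R]_n) -> Prop :=
| weyl_one : weyl \1%VF
| weyl_srefl i : weyl (linfun (srefl i))
| weyl_mul u w of weyl u & weyl w : weyl (u \o w)%VF
| weyl_inv w of weyl w : weyl (w^-1)%VF.

Definition real_root x : Prop :=
  exists w : 'End('rV[R]_n), weyl w /\ exists i, x = w (sroot i).

End RootSystem.

Section Quiver.
Variables (n : nat) (C : cartanDatum n).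
Local Notation d := (cd_d C).

Definition lcmd (i j : 'I_n) : nat := lcmn (d i) (d j).

Definition lcm_all : nat := \big[lcmn/1%N]_i d i.

(* The number of arrows i -> j.  The division is exact: d_i A_ij = d_j A_ji is
   a common multiple of d_i and d_j. *)
Definition narrows (i j : 'I_n) : nat :=
  if i == j then 0%N else (`|- ((d i)%:Z * cd_A C i j)| %/ lcmd i j)%N.

End Quiver.

(* [pd_kap m] is the subextension of degree m, for m dividing L; it is unique
   because the Galois group is cyclic.  An arrow i -> j is an element of
   'I_(narrows C i j).  [pd_basis j i] and [pd_dual j i] are the basis b^{ji}
   and its trace-dual; the trace of the Galois extension
   kappa(d_ij)/kappa(d_j) is [galTrace]. *)
Record preprojDatum (n : nat) (C : cartanDatum n)
    (k : fieldType) (K : splittingFieldType k) := PreprojDatum {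
  pd_galois : galois 1 {:K};
  pd_cyclic : cyclic 'Gal({:K} / 1);
  pd_order : #|'Gal({:K} / 1)%g| = lcm_all C;
  pd_kap : nat -> {subfield K};
  pd_dim_kap : forall m, (m %| lcm_all C)%N -> \dim (pd_kap m) = m;

  pd_star : forall i j : 'I_n, 'I_(narrows C i j) -> 'I_(narrows C j i);
  pd_starK : forall i j (a : 'I_(narrows C i j)), pd_star (pd_star a) = a;

  pd_sgn : 'I_n -> 'I_n -> int;
  pd_sgn_pm1 : forall i j, i != j -> pd_sgn i j = 1 \/ pd_sgn i j = -1;
  pd_sgn_anti : forall i j, i != j -> pd_sgn i j = - pd_sgn j i;

  pd_basis : 'I_n -> 'I_n -> seq K;
  pd_dual : 'I_n -> 'I_n -> seq K;
  pd_basisP : forall i j, i != j ->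
    let F := pd_kap (cd_d C j) in
    basis_of (vspaceOver F (pd_kap (lcmd C i j)))
             (pd_basis j i : seq (fieldOver F));
  pd_dual_size : forall i j, i != j ->
    size (pd_dual j i) = size (pd_basis j i);
  pd_dual_in : forall i j, i != j ->
    {subset pd_dual j i <= pd_kap (lcmd C i j)};
  pd_dualP : forall i j, i != j ->
    forall p q, (p < size (pd_basis j i))%N -> (q < size (pd_basis j i))%N ->
    galTrace (pd_kap (cd_d C j)) (pd_kap (lcmd C i j))
             ((pd_basis j i)`_p * (pd_dual j i)`_q) = (p == q)%:R
}.

Section Modules.
Variables (n : nat) (C : cartanDatum n).
Variables (k : fieldType) (K : splittingFieldType k).
Variable P : preprojDatum C K.

Local Notation kapv i := (subvs_of (pd_kap P (cd_d C i))).
Local Notation kape i j := (subvs_of (pd_kap P (lcmd C i j))).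

(* The bimodule E(j <- i): the kappa(d_ij)-vector space on the arrows i -> j,
   with elements of kappa(d_j) and kappa(d_i) acting by multiplication inside
   kappa(d_ij), which contains both fields. *)
Definition arrow_bimod (i j : 'I_n) := {ffun 'I_(narrows C i j) -> kape i j}.

Definition bimodl (i j : 'I_n) (c : kapv j) (e : arrow_bimod i j) :
    arrow_bimod i j :=
  [ffun a => vsproj (pd_kap P (lcmd C i j)) (vsval c * vsval (e a))].

Definition bimodr (i j : 'I_n) (e : arrow_bimod i j) (c : kapv i) :
    arrow_bimod i j :=
  [ffun a => vsproj (pd_kap P (lcmd C i j)) (vsval (e a) * vsval c)].

(* The element x a = a x of E(j <- i), for x in kappa(d_ij). *)
Definition arrow_coef (i j : 'I_n) (x : K) (a : 'I_(narrows C i j)) :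
    arrow_bimod i j :=
  [ffun b => if b == a then vsproj (pd_kap P (lcmd C i j)) x else 0].

(* A structure of Lambda-module on a family of kappa(d_i)-vector spaces M_i:
   kappa(d_j)-linear maps E(j <- i) (x) M_i -> M_j, tensor over kappa(d_i),
   given as balanced biadditive maps, subject to the preprojective relations.
   For i = j there are no arrows, so the map is zero. *)
Record lamStruct (M : forall i : 'I_n, lmodType (kapv i)) := LamStruct {
  lact : forall i j : 'I_n, arrow_bimod i j -> M i -> M j;
  lactDl : forall i j (e f : arrow_bimod i j) x,
    lact (e + f) x = lact e x + lact f x;
  lactDr : forall i j (e : arrow_bimod i j) x y,
    lact e (x + y) = lact e x + lact e y;
  lact_bal : forall i j (e : arrow_bimod i j) (c : kapv i) x,
    lact (bimodr e c) x = lact e (c *: x);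
  lact_lin : forall i j (c : kapv j) (e : arrow_bimod i j) x,
    lact (bimodl c e) x = c *: lact e x;
  lact_rel : forall i (x : M i),
    \sum_(j | j != i)
      (\sum_(a < narrows C i j) \sum_(p < size (pd_basis P j i))
        lact (arrow_coef (pd_dual P j i)`_p (pd_star P a))
             (lact (arrow_coef (pd_basis P j i)`_p a) x)) *~ pd_sgn P i j = 0
}.

Record lamModule := LamModule {
  lm_car :> forall i : 'I_n, lmodType (kapv i);
  lm_str : lamStruct lm_car
}.

Definition lmact (M : lamModule) i j : arrow_bimod i j -> M i -> M j :=
  @lact _ (lm_str M) i j.

(* Being finite dimensional over kappa and over kappa(d_i) is the same, the
   extension kappa(d_i)/kappa being finite. *)
Record fdLamModule := FdLamModule {
  fd_car : forall i : 'I_n, vectType (kapv i);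
  fd_str : lamStruct (fun i => fd_car i : lmodType (kapv i))
}.

Coercion fd_lamModule (B : fdLamModule) : lamModule := LamModule (fd_str B).

Definition dimvec (R : realType) (B : fdLamModule) : 'rV[R]_n :=
  \sum_i (\dim {: fd_car B i})%:R *: sroot R i.

Record lamHom (M N : lamModule) := LamHom {
  lhom :> forall i : 'I_n, {linear M i -> N i};
  lhomP : forall i j (e : arrow_bimod i j) (x : M i),
    lhom j (lmact e x) = lmact e (lhom i x)
}.

(* The second clause says that every nonzero element of
   the endomorphism ring is invertible; that ring is nontrivial by the first. *)
Definition brick (B : fdLamModule) : Prop :=
  (exists i, exists x : lm_car B i, x != 0) /\
  (forall f : lamHom B B, (exists i, exists x : lm_car B i, f i x != 0) ->
     exists g : lamHom B B,
       forall i, cancel (f i) (g i) /\ cancel (g i) (f i)).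

(* An element of Ext^1(M, N) in the sense of Yoneda is represented by a short
   exact sequence 0 -> N -> X -> M -> 0. *)
Record extension (M N : lamModule) := Extension {
  ext_mid : lamModule;
  ext_in : lamHom N ext_mid;
  ext_out : lamHom ext_mid M;
  ext_in_inj : forall i, injective (ext_in i);
  ext_out_surj : forall i y, exists x, ext_out i x = y;
  ext_exact : forall i x, ext_out i x = 0 <-> exists y, x = ext_in i y
}.

Definition ext_equiv (M N : lamModule) (E E' : extension M N) : Prop :=
  exists f : lamHom (ext_mid E) (ext_mid E'),
    (forall i y, f i (ext_in E i y) = ext_in E' i y) /\
    (forall i x, ext_out E' i (f i x) = ext_out E i x).

Section SplitExtension.
Variables M N : lamModule.

Definition dsum_car (i : 'I_n) : lmodType (kapv i) := (N i * M i)%type.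

Definition dsum_act i j (e : arrow_bimod i j) (x : dsum_car i) : dsum_car j :=
  (lmact e x.1, lmact e x.2).

Fact dsum_actDl i j (e f : arrow_bimod i j) x :
  dsum_act (e + f) x = dsum_act e x + dsum_act f x.
Proof. by rewrite /dsum_act /lmact !lactDl. Qed.

Fact dsum_actDr i j (e : arrow_bimod i j) x y :
  dsum_act e (x + y) = dsum_act e x + dsum_act e y.
Proof. by rewrite /dsum_act /lmact !lactDr. Qed.

Fact dsum_act_bal i j (e : arrow_bimod i j) (c : kapv i) x :
  dsum_act (bimodr e c) x = dsum_act e (c *: x).
Proof. by rewrite /dsum_act /lmact !lact_bal. Qed.

Fact dsum_act_lin i j (c : kapv j) (e : arrow_bimod i j) x :
  dsum_act (bimodl c e) x = c *: dsum_act e x.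
Proof. by rewrite /dsum_act /lmact !lact_lin. Qed.

Fact dsum_act_rel i (x : dsum_car i) :
  \sum_(j | j != i)
    (\sum_(a < narrows C i j) \sum_(p < size (pd_basis P j i))
      dsum_act (arrow_coef (pd_dual P j i)`_p (pd_star P a))
        (dsum_act (arrow_coef (pd_basis P j i)`_p a) x)) *~ pd_sgn P i j = 0.
Proof.
apply: injective_projections => /=.
- rewrite (raddf_sum fst) -[RHS](lact_rel (lm_str N) x.1).
  apply: eq_bigr => j _; rewrite (raddfMz fst) (raddf_sum fst); congr (_ *~ _).
  by apply: eq_bigr => a _; rewrite (raddf_sum fst).
- rewrite (raddf_sum snd) -[RHS](lact_rel (lm_str M) x.2).
  apply: eq_bigr => j _; rewrite (raddfMz snd) (raddf_sum snd); congr (_ *~ _).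
  by apply: eq_bigr => a _; rewrite (raddf_sum snd).
Qed.

Definition dsum : lamModule :=
  LamModule (LamStruct dsum_actDl dsum_actDr dsum_act_bal dsum_act_lin
                       dsum_act_rel).

Definition dsum_in_fun (i : 'I_n) (y : N i) : dsum i := (y, 0).

Fact dsum_in_linear i : linear (@dsum_in_fun i).
Proof.
by move=> c y z; apply: injective_projections; rewrite /= ?scaler0 ?addr0.
Qed.
HB.instance Definition _ i :=
  GRing.isLinear.Build _ (N i) (dsum i) *:%R (@dsum_in_fun i) (@dsum_in_linear i).

Fact dsum_in_hom i j (e : arrow_bimod i j) (y : N i) :
  dsum_in_fun (lmact e y) = lmact (M := dsum) e (dsum_in_fun y).
Proof.
apply: injective_projections => //=.
by apply: (addrI (lmact e 0)); rewrite /lmact -lactDr !addr0.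
Qed.

Definition dsum_in : lamHom N dsum :=
  LamHom (lhom := fun i => @dsum_in_fun i : {linear _ -> _}) dsum_in_hom.

Definition dsum_out_fun (i : 'I_n) (x : dsum i) : M i := x.2.

Fact dsum_out_linear i : linear (@dsum_out_fun i). Proof. by []. Qed.
HB.instance Definition _ i :=
  GRing.isLinear.Build _ (dsum i) (M i) *:%R (@dsum_out_fun i)
    (@dsum_out_linear i).

Fact dsum_out_hom i j (e : arrow_bimod i j) (x : dsum i) :
  dsum_out_fun (lmact e x) = lmact e (dsum_out_fun x).
Proof. by []. Qed.

Definition dsum_out : lamHom dsum M :=
  LamHom (lhom := fun i => @dsum_out_fun i : {linear _ -> _}) dsum_out_hom.

Fact dsum_in_inj i : injective (dsum_in i).
Proof. by move=> y z []. Qed.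

Fact dsum_out_surj i (y : M i) : exists x, dsum_out i x = y.
Proof. by exists (0, y). Qed.

Fact dsum_exact i (x : dsum i) :
  dsum_out i x = 0 <-> exists y, x = dsum_in i y.
Proof.
split=> [x20|[y ->]] //; exists x.1.
by apply: injective_projections.
Qed.

Definition split_extension : extension M N :=
  Extension dsum_in_inj dsum_out_surj dsum_exact.

End SplitExtension.

(* Ext^1(M, N) is the set of equivalence classes of extensions, with zero the
   class of the split one.  A morphism of extensions as in [ext_equiv] is
   automatically an isomorphism (five lemma), so no symmetrization is needed. *)
Definition Ext1_eq0 (M N : lamModule) : Prop :=
  forall E : extension M N, ext_equiv E (split_extension M N).

Definition rigid (M : lamModule) : Prop := Ext1_eq0 M M.

End Modules.

(* Main.v *)
From HB Require Import structures.
Require Import Defs.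
From mathcomp Require Import all_boot all_order all_algebra.
From mathcomp Require Import all_fingroup all_solvable all_field.
From mathcomp Require Import boolp reals ring zify.

(** Coordinates turn a finite dimensional module M into matrices.  An arrow
    a : i -> j acts by x a . v = tr (x Q_a v) for one matrix Q_a over
    kappa(d_ij), the trace being that of kappa(d_ij) over kappa(d_j), and
    the preprojective relation at i becomes the moment map equation
    sum_a sgn(a) tr (Q_{a^*} Q_a) = 0, the sum being over the arrows that
    leave i and the traces going down to kappa(d_i) ([rel_compE]).
    Morphisms, self-extensions and their splittings become families of
    matrices too: endomorphisms F with F Q = Q F, cocycles X solving the
    linearized moment map equation, and coboundaries X = F Q - Q F
    ([brick_module_mx], [rigid_module_mx], [module_mx_rigid]).

    At a vertex i the matrices of the arrows at i are the same thing as two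
    linear maps out : M_i -> M~_i and in : M~_i -> M_i, where M~_i is the sum
    over j of E(i <- j) (x) M_j.  The relation at i reads in o out = 0, and the
    relations at the other vertices see only theta = out o in.  When out is
    injective, M_i may be replaced by the cokernel of out without changing
    theta; this is the reflection functor, and it acts on dimension vectors
    by the simple reflection s_i.  Both modules amount to the M_j with j <> i
    together with theta and one subspace of M~_i, the image of out.  Hence they
    have the same endomorphisms and, applying this to first order
    deformations, the same self-extensions; what is needed of this is that
    bricks go to bricks ([brick_reflect]) and that rigidity comes back
    ([rigid_reflect]).  Transposing all matrices is a duality exchanging out
    and in, so the case where in is surjective is covered as well.

    A real root has positive norm because W preserves the form and
    (alpha_i, alpha_i) = 2 d_i ([real_root_form_gt0]).

    Let B be a brick whose dimension vector beta has positive norm.  Some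
    simple root satisfies (beta, alpha_i) > 0, that is dim M~_i < 2 dim M_i.  If
    out has a kernel and in is not surjective, then B -> S_i -> B is a nonzero
    endomorphism of rank one, hence B = S_i ([brick_out_inj]).  Otherwise a
    reflection at i gives a brick of smaller dimension whose dimension vector
    s_i beta has the same norm.  By induction ([brick_induction]) beta is a
    real root, and B is rigid since the simple modules are.

    Finally, if B is rigid then counting dimensions over kappa in the complex
    C^0 -> C^1 -> C^0 of vertex families, arrow families and moment maps gives
    dim C^1 < 2 dim C^0, because the identity of B is a nonzero element with
    zero coboundary ([rigid_dim]).  This inequality says (beta, beta) > 0, and
    the previous paragraph applies. *)

Set Implicit Arguments.
Unset Strict Implicit.
Unset Printing Implicit Defensive.

Import Order.TTheory GRing.Theory Num.Theory.
Local Open Scope ring_scope.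

(** * Splitting injective matrices *)
Section SplitInjective.
Variables (F : fieldType) (D N m : nat).

(** An injective matrix O on the first m coordinates is completed to a split
    short exact sequence: R retracts O, while J is a cokernel of O with
    section S.  The source of O and its cokernel are both padded to size N. *)
Lemma split_injective_mx (O : 'M[F]_(D, N)) :
  (m <= N)%N -> O *m pid_mx m = O ->
  (forall v : 'cV_N, pid_mx m *m v = v -> O *m v = 0 -> v = 0) ->
  (D - m <= N)%N ->
  (m <= D)%N /\ exists (R : 'M[F]_(N, D)) (S : 'M[F]_(D, N)) (J : 'M[F]_(N, D)),
  [/\ [/\ R *m O = pid_mx m, pid_mx m *m R = R, J *m O = 0 &
      J *m S = pid_mx (D - m)], pid_mx (D - m) *m J = J,
      S *m pid_mx (D - m) = S & O *m R + S *m J = 1%:M].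
Proof.
move=> lemN Oe Oinj ledN.
have pmm : (pid_mx m : 'M[F]_(m, N)) *m (pid_mx m : 'M_(N, m)) = 1%:M.
  by rewrite pid_mx_id // pid_mx_1.
pose O0 := O *m (pid_mx m : 'M_(N, m)).
have O0E : O0 *m (pid_mx m : 'M_(m, N)) = O by rewrite -mulmxA pid_mx_id.
have fO0 : row_free O0^T.
  apply: inj_row_free => v /(congr1 trmx); rewrite trmx_mul trmxK trmx0 => Ov.
  have /(congr1 (fun w => (pid_mx m : 'M_(m, N)) *m w)) : (pid_mx m : 'M_(N, m)) *m v^T = 0.
    by apply: Oinj; rewrite mulmxA ?pid_mx_id // -/O0 Ov.
  rewrite mulmx0 mulmxA pmm mul1mx => /(congr1 trmx).
  by rewrite trmxK trmx0.
pose R0 := (pinvmx O0^T)^T.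
have RO : R0 *m O0 = 1%:M.
  by rewrite -[O0]trmxK -trmx_mul mulmxVp // trmx1.
have lemD : (m <= D)%N by apply: mulmx1_min RO.
split=> //.
(* The idempotent with kernel the image of O; a rank factorization S0 J0 of it
   provides the cokernel and its section. *)
pose E := 1%:M - O0 *m R0.
have EO : E *m O0 = 0 by rewrite mulmxBl mul1mx -mulmxA RO mulmx1 subrr.
have RE : R0 *m E = 0 by rewrite mulmxBr mulmx1 mulmxA RO mul1mx subrr.
have EE : E *m E = E by rewrite {2}/E mulmxBr mulmx1 mulmxA EO mul0mx subr0.
pose S0 := col_base E; pose J0 := row_base E.
have SJ : S0 *m J0 = E by rewrite mulmx_base.
have JS : J0 *m S0 = 1%:M.
  apply: (row_full_inj (col_base_full E)); apply: (row_free_inj (row_base_free E)).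
  by rewrite mulmx1 -/S0 -/J0 mulmxA -[_ *m S0 *m _]mulmxA SJ EE.
have JO : J0 *m O0 = 0.
  by rewrite -[J0]mul1mx -JS -[_ *m J0]mulmxA SJ -mulmxA EO mulmx0.
have RS : R0 *m S0 = 0.
  by rewrite -[S0]mulmx1 -JS 2!mulmxA -[_ *m S0 *m _]mulmxA SJ RE mul0mx.
have rE : \rank E = (D - m)%N.
  have h1 : col_mx R0 J0 *m row_mx O0 S0 = 1%:M.
    by rewrite mul_col_row RO RS JO JS -scalar_mx_block.
  have h2 : row_mx O0 S0 *m col_mx R0 J0 = 1%:M.
    by rewrite mul_row_col SJ /E addrC subrK.
  apply/eqP; rewrite -(eqn_add2l m) subnKC // eqn_leq.
  by rewrite (mulmx1_min h1) (mulmx1_min h2).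
have ledN' := ledN; rewrite -rE in ledN'.
rewrite -rE.
exists ((pid_mx m : 'M_(N, m)) *m R0), (S0 *m (pid_mx (\rank E) : 'M_(\rank E, N))),
  ((pid_mx (\rank E) : 'M_(N, \rank E)) *m J0); split.
- split.
  + by rewrite -{1}O0E mulmxA -[_ *m R0 *m _]mulmxA RO mulmx1 pid_mx_id.
  + by rewrite mulmxA pid_mx_id.
  + by rewrite -O0E mulmxA -[_ *m J0 *m _]mulmxA JO mulmx0 mul0mx.
  + by rewrite mulmxA -[_ *m J0 *m _]mulmxA JS mulmx1 pid_mx_id.
- by rewrite mulmxA pid_mx_id.
- by rewrite -mulmxA pid_mx_id.
- rewrite mulmxA -/O0 -mulmxA [_ *m (_ *m J0)]mulmxA pid_mx_id // pid_mx_1 mul1mx SJ.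
  by rewrite /E addrC subrK.
Qed.

End SplitInjective.

Section SplitOver.
Variables (k : fieldType) (K : fieldExtType k) (E : {subfield K}).
Variables (D N m : nat).

Lemma mxOver_vsval p q (A : 'M[subvs_of E]_(p, q)) :
  map_mx vsval A \is a mxOver E.
Proof. by apply/mxOverP=> x y; rewrite mxE subvsP. Qed.

Lemma mxOver_vsprojK p q (A : 'M[K]_(p, q)) :
  A \is a mxOver E -> map_mx vsval (map_mx (vsproj E) A) = A.
Proof. by move=> /mxOverP AE; apply/matrixP=> x y; rewrite !mxE vsprojK. Qed.

(** The completion can be done with entries in the subfield E: linear algebra
    over E is transported along the inclusion of E. *)
Lemma split_injective_mxOver (O : 'M[K]_(D, N)) :
  O \is a mxOver E -> (m <= N)%N -> O *m pid_mx m = O ->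
  (forall v : 'cV_N, v \is a mxOver E -> pid_mx m *m v = v -> O *m v = 0 ->
     v = 0) ->
  (D - m <= N)%N ->
  (m <= D)%N /\ exists (R : 'M[K]_(N, D)) (S : 'M[K]_(D, N)) (J : 'M[K]_(N, D)),
  [/\ [/\ R \is a mxOver E, S \is a mxOver E & J \is a mxOver E],
      [/\ R *m O = pid_mx m, pid_mx m *m R = R, J *m O = 0 &
      J *m S = pid_mx (D - m)], pid_mx (D - m) *m J = J,
      S *m pid_mx (D - m) = S & O *m R + S *m J = 1%:M].
Proof.
move=> OE lemN Oe Oinj ledN.
have vsI p q : injective (@map_mx _ K (@vsval k K E) p q).
  by move=> A B /matrixP AB; apply/matrixP=> x y; have := AB x y; rewrite !mxE => /val_inj.
have Oe' : map_mx (vsproj E) O *m pid_mx m = map_mx (vsproj E) O.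
  by apply: vsI; rewrite map_mxM map_pid_mx mxOver_vsprojK.
have Oinj' : forall v : 'cV_N, pid_mx m *m v = v ->
    map_mx (vsproj E) O *m v = 0 -> v = 0.
  move=> v ev Ov; apply: vsI; rewrite map_mx0; apply: Oinj (mxOver_vsval _) _ _.
    by rewrite -[in RHS]ev map_mxM map_pid_mx.
  by rewrite -[O]mxOver_vsprojK // -map_mxM Ov map_mx0.
have [lemD [R [S [J [[RO eR JO JS] eJ Se OR]]]]] :=
  split_injective_mx lemN Oe' Oinj' ledN.
split=> //.
have OV := mxOver_vsprojK OE.
exists (map_mx vsval R), (map_mx vsval S), (map_mx vsval J).
rewrite !mxOver_vsval -OV -!map_mxM RO JO JS !map_pid_mx map_mx0.
have pE p q r : pid_mx r = map_mx (@vsval k K E) (pid_mx r) :> 'M_(p, q).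
  by rewrite map_pid_mx.
by rewrite !pE -!map_mxM -map_mxD eR eJ Se OR map_mx1.
Qed.

End SplitOver.

(** * Species and their matrix representations *)

(** The data that a preprojective algebra uses: arrows with an orientation
    reversing involution, a field at each vertex and on each arrow, and on
    arrow fields a trace to the source field together with a pair of dual
    bases [sp_eb], [sp_ed] for the trace form.  The dual bases are functions
    on nat of which the first [sp_rk a] values matter. *)
Record species (k : fieldType) (K : fieldExtType k) (n : nat) := Species {
  sp_arrow : finType;
  sp_src : sp_arrow -> 'I_n;
  sp_opp : sp_arrow -> sp_arrow;
  sp_oppK : involutive sp_opp;
  sp_noloop : forall a, sp_src (sp_opp a) != sp_src a;
  sp_kv : 'I_n -> {subfield K};
  sp_ka : sp_arrow -> {subfield K};
  sp_ka_opp : forall a, sp_ka (sp_opp a) = sp_ka a;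
  sp_kv_sub : forall a, (sp_kv (sp_src a) <= sp_ka a)%VS;
  sp_sg : sp_arrow -> bool;
  sp_tr : sp_arrow -> {additive K -> K};
  sp_trZ : forall a c x, c \in sp_kv (sp_src a) ->
    sp_tr a (c * x) = c * sp_tr a x;
  sp_tr_in : forall a x, x \in sp_ka a -> sp_tr a x \in sp_kv (sp_src a);
  sp_rk : sp_arrow -> nat;
  sp_eb : sp_arrow -> nat -> K;
  sp_ed : sp_arrow -> nat -> K;
  sp_eb_in : forall a p, sp_eb a p \in sp_ka a;
  sp_ed_in : forall a p, sp_ed a p \in sp_ka a;
  sp_dual : forall a p q, (p < sp_rk a)%N -> (q < sp_rk a)%N ->
    sp_tr a (sp_eb a p * sp_ed a q) = (p == q)%:R;
  sp_expand : forall a x, x \in sp_ka a ->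
    x = \sum_(p < sp_rk a) sp_tr a (sp_eb a p * x) * sp_ed a p;
  sp_dim : forall a, \dim (sp_ka a) = (sp_rk a * \dim (sp_kv (sp_src a)))%N
}.

Section PaddedMatrices.
Variables (k : fieldType) (K : fieldExtType k) (N : nat).
Implicit Types (E : {subfield K}) (A B : 'M[K]_N).

(** An r x c matrix over E, written as a square matrix of a size N that does not
    depend on r and c.  Keeping N fixed lets a dimension vector change without
    changing the type of the matrices. *)
Definition padded E r c A := A \is a mxOver E /\ pid_mx r *m A *m pid_mx c = A.

Lemma mxOver_pid E p q r : pid_mx r \is a @mxOver p q K E.
Proof. by apply/mxOverP=> x y; rewrite mxE rpred_nat. Qed.

Lemma pid_mx_idem r : (pid_mx r : 'M[K]_N) *m (pid_mx r : 'M[K]_N) = pid_mx r.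
Proof. by rewrite mul_pid_mx minnn pid_mx_minv. Qed.

Lemma paddedP E r c A :
  A \is a mxOver E -> pid_mx r *m A = A -> A *m pid_mx c = A -> padded E r c A.
Proof. by move=> AE rA Ac; split=> //; rewrite rA Ac. Qed.

Lemma padded_over E r c A : padded E r c A -> A \is a mxOver E.
Proof. by case. Qed.

Lemma padded_l E r c A : padded E r c A -> pid_mx r *m A = A.
Proof. by case=> _ <-; rewrite !mulmxA pid_mx_idem. Qed.

Lemma padded_r E r c A : padded E r c A -> A *m pid_mx c = A.
Proof. by case=> _ <-; rewrite -!mulmxA pid_mx_idem. Qed.

Lemma padded_sub E1 E2 r c A : (E1 <= E2)%VS -> padded E1 r c A -> padded E2 r c A.
Proof. by move=> /subvP sE [AE ?]; split=> //; apply: mxOverS AE. Qed.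

Lemma padded0 E r c : padded E r c 0.
Proof. by split; rewrite ?mxOver0 ?mem0v // mulmx0 mul0mx. Qed.

Lemma padded_pid E r : padded E r r (pid_mx r).
Proof. by apply: paddedP; rewrite ?mxOver_pid ?pid_mx_idem. Qed.

Lemma paddedD E r c A B : padded E r c A -> padded E r c B -> padded E r c (A + B).
Proof.
move=> gA gB; apply: paddedP.
- by rewrite rpredD // ?(padded_over gA) ?(padded_over gB).
- by rewrite mulmxDr (padded_l gA) (padded_l gB).
- by rewrite mulmxDl (padded_r gA) (padded_r gB).
Qed.

Lemma paddedN E r c A : padded E r c A -> padded E r c (- A).
Proof.
move=> gA; apply: paddedP.
- by rewrite rpredN (padded_over gA).
- by rewrite mulmxN (padded_l gA).
- by rewrite mulNmx (padded_r gA).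
Qed.

Lemma paddedM E r s c A B : padded E r s A -> padded E s c B -> padded E r c (A *m B).
Proof.
move=> gA gB; apply: paddedP.
- exact: mxOverM (padded_over gA) (padded_over gB).
- by rewrite mulmxA (padded_l gA).
- by rewrite -mulmxA (padded_r gB).
Qed.

Lemma paddedT E r c A : padded E r c A -> padded E c r A^T.
Proof.
move=> gA; apply: paddedP.
- by apply/mxOverP=> x y; rewrite mxE (mxOverP (padded_over gA)).
- by rewrite -[pid_mx c]trmxK tr_pid_mx -trmx_mul (padded_r gA).
- by rewrite -[pid_mx r]trmxK tr_pid_mx -trmx_mul (padded_l gA).
Qed.

(** Adding the complementary idempotent to A and to B makes them invertible
    matrices of size N, for which a right inverse is a left inverse. *)
Lemma padded_mulC E r A B :
  padded E r r A -> padded E r r B -> A *m B = pid_mx r -> B *m A = pid_mx r.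
Proof.
move=> gA gB AB; pose e := 1%:M - pid_mx r : 'M[K]_N.
have ee : e *m e = e.
  by rewrite mulmxBl mul1mx mulmxBr mulmx1 pid_mx_idem subrr subr0.
have eA : e *m A = 0 by rewrite mulmxBl mul1mx (padded_l gA) subrr.
have Ae : A *m e = 0 by rewrite mulmxBr mulmx1 (padded_r gA) subrr.
have eB : e *m B = 0 by rewrite mulmxBl mul1mx (padded_l gB) subrr.
have Be : B *m e = 0 by rewrite mulmxBr mulmx1 (padded_r gB) subrr.
have e1 : pid_mx r + e = 1%:M by rewrite addrC subrK.
clearbody e.
have : (A + e) *m (B + e) = 1%:M.
  by rewrite mulmxDl !mulmxDr AB Ae eB ee addr0 add0r.
move/mulmx1C; rewrite mulmxDl !mulmxDr Be eA ee addr0 add0r => BA.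
by apply: (addIr e); rewrite BA.
Qed.

End PaddedMatrices.

Section PaddedEntries.
Variables (k : fieldType) (K : fieldExtType k) (N : nat).
Implicit Types (E : {subfield K}).

Lemma mul_pid_mxE p q r (A : 'M[K]_(p, q)) s t :
  (pid_mx r *m A) s t = (if (s < r)%N then A s t else 0).
Proof.
rewrite mxE (bigD1 s) //= big1 ?addr0 ?mxE ?eqxx //= => [|u us].
  by case: ifP; rewrite ?mul1r ?mul0r.
by rewrite mxE (_ : s == u :> nat = false) ?mul0r // eq_sym; apply: negPf us.
Qed.

Lemma mul_mx_pidE p q c (A : 'M[K]_(p, q)) s t :
  (A *m pid_mx c) s t = (if (t < c)%N then A s t else 0).
Proof.
rewrite mxE (bigD1 t) //= big1 ?addr0 ?mxE ?eqxx //= => [|u us].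
  by case: ifP; rewrite ?mulr1 ?mulr0.
by rewrite mxE (_ : u == t :> nat = false) ?mulr0 //; apply: negPf us.
Qed.

Lemma padded_in E r c (A : 'M[K]_N) s t : padded E r c A -> A s t \in E.
Proof. by move=> /padded_over/mxOverP. Qed.

Lemma padded_row0 E r c (A : 'M[K]_N) (s t : 'I_N) :
  padded E r c A -> (s < r)%N = false -> A s t = 0.
Proof. by move=> gA sr; rewrite -(padded_l gA) mul_pid_mxE sr. Qed.

Lemma padded_col0 E r c (A : 'M[K]_N) (s t : 'I_N) :
  padded E r c A -> (t < c)%N = false -> A s t = 0.
Proof. by move=> gA sr; rewrite -(padded_r gA) mul_mx_pidE sr. Qed.

Lemma padded_entries E r c (A : 'M[K]_N) :
  (forall s t, A s t \in E) ->
  (forall s t : 'I_N, (s < r)%N = false -> A s t = 0) ->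
  (forall s t : 'I_N, (t < c)%N = false -> A s t = 0) -> padded E r c A.
Proof.
move=> AE A0 A1; apply: paddedP; first exact/mxOverP.
  by apply/matrixP=> s t; rewrite mul_pid_mxE; case: ifP => // /A0->.
by apply/matrixP=> s t; rewrite mul_mx_pidE; case: ifP => // /A1->.
Qed.

End PaddedEntries.

Section SpeciesTheory.
Variables (k : fieldType) (K : fieldExtType k) (n : nat) (P : species K n).
Notation src := (@sp_src _ _ _ P).
Notation opp := (@sp_opp _ _ _ P).
Notation kv := (sp_kv P).
Notation ka := (@sp_ka _ _ _ P).
Notation tr := (@sp_tr _ _ _ P).
Notation rk := (@sp_rk _ _ _ P).
Notation eb := (@sp_eb _ _ _ P).
Notation ed := (@sp_ed _ _ _ P).
Notation sg := (@sp_sg _ _ _ P).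
Notation tgt a := (src (opp a)).

Lemma sp_kv_tgt a : (kv (tgt a) <= ka a)%VS.
Proof. by rewrite -(sp_ka_opp a) sp_kv_sub. Qed.

Lemma sp_trZr a c x : c \in kv (src a) -> tr a (x * c) = tr a x * c.
Proof. by move=> cE; rewrite mulrC sp_trZ // mulrC. Qed.

Lemma sp_tr_nondeg a x : x \in ka a ->
  (forall y, y \in ka a -> tr a (y * x) = 0) -> x = 0.
Proof.
move=> xE x0; rewrite (sp_expand xE) big1 // => p _.
by rewrite x0 ?mul0r // sp_eb_in.
Qed.

(** The expansion with the two dual bases exchanged: the difference of the two
    sides is orthogonal to every [ed a p], hence to the whole field. *)
Lemma sp_expand_r a x : x \in ka a ->
  x = \sum_(p < rk a) tr a (x * ed a p) * eb a p.
Proof.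
move=> xE; set y := \sum_(p < _) _.
have yE : y \in ka a.
  rewrite rpred_sum // => p _; rewrite rpredM ?sp_eb_in //.
  by apply: (subvP (sp_kv_sub a)); rewrite sp_tr_in // rpredM ?sp_ed_in.
apply/eqP; rewrite -subr_eq0; apply/eqP; apply: (@sp_tr_nondeg a).
  by rewrite rpredB.
move=> z zE; rewrite {1}(sp_expand zE) mulr_suml raddf_sum big1 // => p _.
have tin w : w \in ka a -> tr a w \in kv (src a) by exact: sp_tr_in.
rewrite -mulrA [tr a (tr a _ * _)]sp_trZ ?tin ?rpredM ?sp_eb_in //.
rewrite mulrBr raddfB mulr_sumr raddf_sum (bigD1 p) //= big1.
  rewrite addr0 mulrCA [tr a (tr a _ * _)]sp_trZ ?tin ?rpredM ?sp_ed_in //.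
  rewrite [ed a p * eb a p]mulrC sp_dual ?ltn_ord // eqxx mulr1.
  by rewrite [ed a p * x]mulrC subrr mulr0.
move=> q qp; rewrite mulrCA [tr a (tr a _ * _)]sp_trZ ?tin ?rpredM ?sp_ed_in //.
by rewrite [ed a p * _]mulrC sp_dual ?ltn_ord // (inj_eq val_inj) (negPf qp) mulr0.
Qed.

(** * The maps into and out of a vertex *)
Section Vertex.
Variables (N : nat) (m : 'I_n -> nat) (i : 'I_n).

Definition slot_type := {a : sp_arrow P & ('I_(rk a) * 'I_N)%type}.

(** The coordinates of M~_i over kappa(d_i): an arrow a leaving i, an element of
    the basis of its field over the field of i, and a coordinate at the target
    of a. *)
Definition slots : {set slot_type} :=
  [set x : slot_type | (src (tag x) == i) && (val (tagged x).2 < m (tgt (tag x)))%N].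
Local Notation D := #|slots|.

Definition s_arr (x : 'I_D) : sp_arrow P := tag (enum_val x).
Definition s_ix (x : 'I_D) : nat := (tagged (enum_val x)).1.
Definition s_row (x : 'I_D) : 'I_N := (tagged (enum_val x)).2.

Lemma src_slot x : src (s_arr x) = i.
Proof. by have := enum_valP x; rewrite inE => /andP[/eqP]. Qed.

Lemma s_row_lt x : (s_row x < m (tgt (s_arr x)))%N.
Proof. by have := enum_valP x; rewrite inE => /andP[]. Qed.

Lemma s_ix_lt x : (s_ix x < rk (s_arr x))%N.
Proof. exact: ltn_ord. Qed.

Lemma slot_inj x y : s_arr x = s_arr y -> s_ix x = s_ix y -> s_row x = s_row y -> x = y.
Proof.
move=> hA hI hR; apply: enum_val_inj; move: hA hI hR; rewrite /s_arr /s_ix /s_row.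
case: (enum_val x) => a [p s]; case: (enum_val y) => b [q t] /= ab.
by case: _ / ab q => q pq ->; rewrite (_ : p = q) //; apply: val_inj.
Qed.

Lemma sum_slots (V : nmodType) (F : sp_arrow P -> nat -> 'I_N -> V) :
  \sum_(x < D) F (s_arr x) (s_ix x) (s_row x)
    = \sum_(a | src a == i) \sum_(p < rk a) \sum_(s < N | (s < m (tgt a))%N) F a p s.
Proof.
rewrite -(big_enum_val (fun y : slot_type =>
  F (tag y) (tagged y).1 (tagged y).2)).
have -> : \sum_(a | src a == i) \sum_(p < rk a)
    \sum_(s < N | (s < m (tgt a))%N) F a p s =
  \sum_(a | src a == i) \sum_(ps : 'I_(rk a) * 'I_N | (ps.2 < m (tgt a))%N)
    F a ps.1 ps.2.
  by apply: eq_bigr => a _; rewrite pair_big_dep.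
by rewrite sig_big_dep /=; apply: eq_bigl => y; rewrite inE.
Qed.

Lemma sum_slots_at (V : nmodType) (F : nat -> V) a (s : 'I_N) :
  \sum_(x < D | (s_arr x == a) && (s_row x == s)) F (s_ix x)
    = (if (src a == i) && (s < m (tgt a))%N then \sum_(p < rk a) F p else 0).
Proof.
rewrite big_mkcond (sum_slots (fun b p t => if (b == a) && (t == s) then F p else 0)).
case: (boolP (src a == i)) => /= sa; last first.
  rewrite big1 // => b sb; rewrite big1 // => p _; rewrite big1 // => t _.
  by case: eqP => //= ba; rewrite ba (negPf sa) in sb.
rewrite (bigD1 a) //= [X in _ + X]big1 ?addr0; last first.
  by move=> b /andP[_ /negPf->]; rewrite big1 // => p _; rewrite big1.
rewrite eqxx /=; case: ifP => ls; last first.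
  rewrite big1 // => p _; rewrite big1 // => t lt.
  by case: eqP => // ts; rewrite -ts lt in ls.
apply: eq_bigr => p _; rewrite (bigD1 s) //= eqxx big1 ?addr0 // => t.
by case/andP=> _ /negPf->.
Qed.

Lemma card_slots : (forall j, m j <= N)%N ->
  D = \sum_(a | src a == i) (rk a * m (tgt a))%N.
Proof.
move=> mN; have := sum_slots (fun _ _ _ => 1%N).
rewrite !sum1_card card_ord => ->; apply: eq_bigr => a _.
rewrite (eq_bigr (fun=> m (tgt a))); last first.
  by move=> p _; rewrite (big_ord_narrow (mN _)) sum1_card card_ord.
by rewrite sum_nat_const card_ord.
Qed.

End Vertex.

Section VertexMatrices.
Variables (N : nat) (m : 'I_n -> nat) (i : 'I_n).
Local Notation D := #|slots N m i|.
Implicit Types (X Y : sp_arrow P -> 'M[K]_N) (F : 'I_n -> 'M[K]_N).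
Implicit Types (O : 'M[K]_(D, N)) (I : 'M[K]_(N, D)) (a : sp_arrow P).

(** The linear map M_i -> M~_i made of the components X a with source i, written
    in the coordinates above. *)
Definition out_mx X : 'M[K]_(D, N) :=
  \matrix_(x, t) tr (s_arr x) (eb (s_arr x) (s_ix x) * X (s_arr x) (s_row x) t).

(** The linear map M~_i -> M_i whose component on the arrow a is the trace of
    [Y a], with the sign of the moment map included.  [Y a] stands for the
    matrix of the arrow opposite to a. *)
Definition in_mx Y : 'M[K]_(N, D) :=
  \matrix_(t, x) ((-1) ^+ sg (s_arr x) *
                  tr (s_arr x) (Y (s_arr x) t (s_row x) * ed (s_arr x) (s_ix x))).

(** [out_fam] and [in_fam] invert [out_mx] and [in_mx]: a linear map out of or
    into M~_i comes from a unique family of matrices. *)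
Definition out_fam O a : 'M[K]_N :=
  \matrix_(s, t) \sum_(x | (s_arr x == a) && (s_row x == s)) ed a (s_ix x) * O x t.

Definition in_fam I a : 'M[K]_N :=
  \matrix_(t, s) \sum_(x | (s_arr x == a) && (s_row x == s))
     ((-1) ^+ sg a * I t x) * eb a (s_ix x).

(** The action on M~_i of a family of matrices at the vertices other than i. *)
Definition nbr_mx F : 'M[K]_D :=
  \matrix_(x, y) if s_arr x == s_arr y
    then tr (s_arr x) (eb (s_arr x) (s_ix x) * F (tgt (s_arr x)) (s_row x) (s_row y)
                    * ed (s_arr x) (s_ix y)) else 0.

(** Recovers from an endomorphism M of M~_i the product of the two arrow matrices
    that it is made of, by applying multiplication of the arrow field to the
    diagonal block of a. *)
Definition thru_prod (M : 'M[K]_D) a : 'M[K]_N :=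
  \matrix_(s, s') \sum_(x | (s_arr x == a) && (s_row x == s))
     \sum_(y | (s_arr y == a) && (s_row y == s'))
        (-1) ^+ sg a * (ed a (s_ix x) * eb a (s_ix y) * M x y).

Lemma sign_in (E : {subfield K}) (b : bool) : (-1) ^+ b \in E.
Proof. by rewrite rpredX // rpredN1. Qed.

Lemma tr_in_src a x : src a = i -> x \in ka a -> tr a x \in kv i.
Proof. by move=> <-; apply: sp_tr_in. Qed.

Lemma out_mx_ext X X' : (forall a, src a = i -> X a = X' a) -> out_mx X = out_mx X'.
Proof. by move=> XX; apply/matrixP=> x t; rewrite !mxE XX // src_slot. Qed.

Lemma in_mx_ext X X' : (forall a, src a = i -> X a = X' a) -> in_mx X = in_mx X'.
Proof. by move=> XX; apply/matrixP=> x t; rewrite !mxE XX // src_slot. Qed.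

Lemma out_mxB X X' : out_mx (fun a => X a - X' a) = out_mx X - out_mx X'.
Proof. by apply/matrixP=> x t; rewrite !mxE mulrBr raddfB. Qed.

Lemma in_mxB X X' : in_mx (fun a => X a - X' a) = in_mx X - in_mx X'.
Proof. by apply/matrixP=> x t; rewrite !mxE mulrBl raddfB mulrBr. Qed.

Lemma out_mx_over X : (forall a, src a = i -> X a \is a mxOver (ka a)) ->
  out_mx X \is a mxOver (kv i).
Proof.
move=> XE; apply/mxOverP=> x t; rewrite mxE tr_in_src ?src_slot //.
by rewrite rpredM ?sp_eb_in ?(mxOverP (XE _ (src_slot x))).
Qed.

Lemma in_mx_over X : (forall a, src a = i -> X a \is a mxOver (ka a)) ->
  in_mx X \is a mxOver (kv i).
Proof.
move=> XE; apply/mxOverP=> x t; rewrite mxE rpredM ?sign_in //.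
rewrite tr_in_src ?src_slot //.
by rewrite rpredM ?sp_ed_in ?(mxOverP (XE _ (src_slot t))).
Qed.

Lemma tgt_slot (x : 'I_D) : tgt (s_arr x) != i.
Proof. by apply: contra (sp_noloop (s_arr x)) => /eqP->; rewrite src_slot. Qed.

Lemma nbr_mx_ext F F' : (forall j, j != i -> F j = F' j) -> nbr_mx F = nbr_mx F'.
Proof. by move=> FF; apply/matrixP=> x y; rewrite !mxE FF // tgt_slot. Qed.

Lemma nbr_mx_over F : (forall j, j != i -> F j \is a mxOver (kv j)) ->
  nbr_mx F \is a mxOver (kv i).
Proof.
move=> FE; apply/mxOverP=> x y; rewrite mxE; case: ifP; rewrite ?mem0v // => _.
rewrite tr_in_src ?src_slot // !rpredM ?sp_ed_in ?sp_eb_in //.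
by apply: (subvP (sp_kv_tgt _)); apply: (mxOverP (FE _ (tgt_slot _))).
Qed.

Lemma out_mx_mulr X (A : 'M[K]_N) : A \is a mxOver (kv i) ->
  out_mx X *m A = out_mx (fun a => X a *m A).
Proof.
move=> /mxOverP AE; apply/matrixP=> x t; rewrite !mxE mulr_sumr raddf_sum.
by apply: eq_bigr => u _; rewrite !mxE mulrA [RHS]sp_trZr // src_slot.
Qed.

Lemma in_mx_mull X (A : 'M[K]_N) : A \is a mxOver (kv i) ->
  A *m in_mx X = in_mx (fun a => A *m X a).
Proof.
move=> /mxOverP AE; apply/matrixP=> t x; rewrite !mxE mulr_suml raddf_sum mulr_sumr.
by apply: eq_bigr => u _; rewrite !mxE -mulrA [in RHS]sp_trZ ?src_slot // mulrCA.
Qed.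

Lemma out_fam_padded O c a : src a = i -> O \is a mxOver (kv i) ->
  O *m pid_mx c = O -> padded (ka a) (m (tgt a)) c (out_fam O a).
Proof.
move=> sa /mxOverP OE Oc; apply: padded_entries => [s t|s t st|s t st].
- rewrite mxE rpred_sum // => x _; rewrite rpredM ?sp_ed_in //.
  by apply: (subvP (sp_kv_sub a)); rewrite sa.
- rewrite mxE big_pred0 // => x; apply/negbTE/negP => /andP[/eqP xa /eqP xs].
  by have := s_row_lt x; rewrite xa xs st.
- rewrite mxE big1 // => x _.
  by rewrite -Oc mul_mx_pidE st mulr0.
Qed.

Lemma in_fam_padded I r a : src a = i -> I \is a mxOver (kv i) ->
  pid_mx r *m I = I -> padded (ka a) r (m (tgt a)) (in_fam I a).
Proof.
move=> sa /mxOverP IE rI; apply: padded_entries => [s t|s t st|s t st].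
- rewrite mxE rpred_sum // => x _; rewrite !rpredM ?sp_eb_in ?sign_in //.
  by apply: (subvP (sp_kv_sub a)); rewrite sa.
- rewrite mxE big1 // => x _.
  by rewrite -rI mul_pid_mxE st mulr0 mul0r.
- rewrite mxE big_pred0 // => x; apply/negbTE/negP => /andP[/eqP xa /eqP xs].
  by have := s_row_lt x; rewrite xa xs st.
Qed.

Lemma out_mxK X c a : src a = i -> padded (ka a) (m (tgt a)) c (X a) ->
  out_fam (out_mx X) a = X a.
Proof.
move=> sa gX; apply/matrixP=> s t; rewrite mxE.
transitivity (\sum_(x | (s_arr x == a) && (s_row x == s))
   ed a (@s_ix N m i x) * tr a (eb a (s_ix x) * X a s t)).
  by apply: eq_bigr => x /andP[/eqP xa /eqP xs]; rewrite mxE xa xs.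
rewrite (sum_slots_at _ _ (fun p => ed a p * tr a (eb a p * X a s t))) sa eqxx /=.
case: ifP => st; last by rewrite (padded_row0 _ gX).
rewrite [RHS](sp_expand (padded_in s t gX)).
by apply: eq_bigr => p _; rewrite mulrC.
Qed.

Lemma in_mxK X r a : src a = i -> padded (ka a) r (m (tgt a)) (X a) ->
  in_fam (in_mx X) a = X a.
Proof.
move=> sa gX; apply/matrixP=> t s; rewrite mxE.
transitivity (\sum_(x | (s_arr x == a) && (s_row x == s))
   tr a (X a t s * ed a (@s_ix N m i x)) * eb a (s_ix x)).
  apply: eq_bigr => x /andP[/eqP xa /eqP xs]; rewrite mxE xa xs.
  by rewrite [_ * (_ * tr a _)]mulrA -signr_addb addbb expr0 mul1r.
rewrite (sum_slots_at _ _ (fun p => tr a (X a t s * ed a p) * eb a p)) sa eqxx /=.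
case: ifP => st; last by rewrite (padded_col0 _ gX).
by rewrite -(sp_expand_r (padded_in t s gX)).
Qed.

Lemma out_famK O : O \is a mxOver (kv i) -> out_mx (out_fam O) = O.
Proof.
move=> /mxOverP OE; apply/matrixP=> x t; rewrite !mxE mulr_sumr raddf_sum.
rewrite (bigD1 x) ?eqxx //= big1 ?addr0.
  by rewrite mulrA sp_trZr ?src_slot // sp_dual ?s_ix_lt // eqxx mul1r.
move=> y /andP[/andP[/eqP yx /eqP yr] neq].
rewrite mulrA sp_trZr ?src_slot // sp_dual ?s_ix_lt // -?yx ?s_ix_lt //.
rewrite (_ : s_ix x == s_ix y = false) ?mul0r //; apply: contraNF neq => /eqP e.
by rewrite (slot_inj yx (esym e) yr).
Qed.

Lemma in_famK I : I \is a mxOver (kv i) -> in_mx (in_fam I) = I.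
Proof.
move=> /mxOverP IE; apply/matrixP=> t x; rewrite !mxE mulr_suml raddf_sum mulr_sumr.
have sI (b : bool) y : (-1) ^+ b * I t y \in kv (src (s_arr x)).
  by rewrite src_slot rpredM ?sign_in ?IE.
rewrite (bigD1 x) ?eqxx //= big1 ?addr0.
  rewrite -[_ * eb _ _ * _]mulrA sp_trZ // sp_dual ?s_ix_lt // eqxx mulr1.
  by rewrite mulrA -signr_addb addbb expr0 mul1r.
move=> y /andP[/andP[/eqP yx /eqP yr] neq].
rewrite -[_ * eb _ _ * _]mulrA sp_trZ // sp_dual ?s_ix_lt // -?yx ?s_ix_lt //.
rewrite (_ : s_ix y == s_ix x = false) ?mulr0 //; apply: contraNF neq => /eqP e.
by rewrite (slot_inj yx e yr).
Qed.

(** The composite j -> i -> j along a and its opposite depends on the maps at i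
    only through their composite on M~_i; this is why a reflection at i keeps
    the relations at the other vertices. *)
Lemma out_in_fam O I a : out_fam O a *m in_fam I a = thru_prod (O *m I) a.
Proof.
apply/matrixP=> s s'; rewrite !mxE.
under eq_bigr => u _ do rewrite !mxE mulr_suml.
rewrite exchange_big; apply: eq_bigr => x _ /=.
under eq_bigr => u _ do rewrite mulr_sumr.
rewrite exchange_big; apply: eq_bigr => y _ /=.
rewrite mxE !mulr_sumr; apply: eq_bigr => u _.
by ring.
Qed.

Lemma thru_prodD (M M' : 'M[K]_D) a : thru_prod (M + M') a = thru_prod M a + thru_prod M' a.
Proof.
apply/matrixP=> s s'; rewrite !mxE -big_split; apply: eq_bigr => x _ /=.
by rewrite -big_split; apply: eq_bigr => y _ /=; rewrite mxE !mulrDr.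
Qed.

(** Composing into and out of i contracts a pair of dual bases and leaves the
    traces of the products, that is, the moment map at i. *)
Lemma in_out_mx Y X :
  (forall a, src a = i -> exists r, padded (ka a) r (m (tgt a)) (Y a)) ->
  (forall a, src a = i -> exists c, padded (ka a) (m (tgt a)) c (X a)) ->
  in_mx Y *m out_mx X
   = \sum_(a | src a == i) (-1) ^+ sg a *: map_mx (tr a) (Y a *m X a).
Proof.
move=> gY gX; apply/matrixP=> t t'; rewrite mxE summxE.
transitivity (\sum_(x < D) (-1) ^+ sg (s_arr x) *
   (tr (s_arr x) (Y (s_arr x) t (s_row x) * ed (s_arr x) (s_ix x)) *
    tr (s_arr x) (eb (s_arr x) (s_ix x) * X (s_arr x) (s_row x) t'))).
  by apply: eq_bigr => x _; rewrite !mxE mulrA.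
rewrite (sum_slots _ _ (fun a p s => (-1) ^+ sg a *
   (tr a (Y a t s * ed a p) * tr a (eb a p * X a s t')))).
apply: eq_bigr => a /eqP sa; rewrite !mxE raddf_sum mulr_sumr exchange_big /=.
have [[r gYa] [c gXa]] := (gY a sa, gX a sa).
rewrite big_mkcond; apply: eq_bigr => s _; case: ifP => sm; last first.
  by rewrite (padded_row0 _ gXa sm) mulr0 raddf0 mulr0.
rewrite -mulr_sumr; congr (_ * _).
rewrite {2}(sp_expand (padded_in s t' gXa)) mulr_sumr raddf_sum.
apply: eq_bigr => p _; rewrite mulrCA [RHS]sp_trZ 1?mulrC //.
by rewrite sp_tr_in // rpredM ?sp_eb_in ?(padded_in _ _ gXa).
Qed.

Lemma nbr_out_mx F X :
  (forall a, src a = i -> exists c, padded (ka a) (m (tgt a)) c (X a)) ->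
  nbr_mx F *m out_mx X = out_mx (fun a => F (tgt a) *m X a).
Proof.
move=> gX; apply/matrixP=> x t; rewrite mxE.
transitivity (\sum_(y < D) if s_arr y == s_arr x then
   tr (s_arr x) (eb (s_arr x) (s_ix x) *
      F (tgt (s_arr x)) (s_row x) (s_row y) * ed (s_arr x) (s_ix y))
    * tr (s_arr x) (eb (s_arr x) (s_ix y) * X (s_arr x) (s_row y) t) else 0).
  apply: eq_bigr => y _; rewrite !mxE eq_sym.
  by case: eqP => [->|]; rewrite ?mul0r.
rewrite (sum_slots _ _ (fun a p s => if a == s_arr x then
   tr (s_arr x) (eb (s_arr x) (s_ix x) * F (tgt (s_arr x)) (s_row x) s * ed (s_arr x) p)
    * tr (s_arr x) (eb (s_arr x) p * X (s_arr x) s t) else 0)).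
rewrite (bigD1 (s_arr x)) ?src_slot //= [X in _ + X]big1 ?addr0; last first.
  by move=> a /andP[_ /negPf->]; rewrite big1 // => p _; rewrite big1.
rewrite eqxx mxE exchange_big /= big_mkcond !mxE mulr_sumr raddf_sum.
have [c gXa] := gX _ (src_slot x).
apply: eq_bigr => s _; case: ifP => sm; last first.
  by rewrite (padded_row0 _ gXa sm) !mulr0 raddf0.
rewrite mulrA [in RHS](sp_expand (padded_in s t gXa)) mulr_sumr raddf_sum.
apply: eq_bigr => p _; rewrite mulrCA [RHS]sp_trZ 1?mulrC //.
by rewrite sp_tr_in // rpredM ?sp_eb_in ?(padded_in _ _ gXa).
Qed.

Lemma in_nbr_mx F Y : (forall j, j != i -> padded (kv j) (m j) (m j) (F j)) ->
  in_mx Y *m nbr_mx F = in_mx (fun a => Y a *m F (tgt a)).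
Proof.
move=> gF; apply/matrixP=> t x; rewrite mxE.
transitivity (\sum_(y < D) if s_arr y == s_arr x then (-1) ^+ sg (s_arr x) *
   (tr (s_arr x) (Y (s_arr x) t (s_row y) * ed (s_arr x) (s_ix y)) *
   tr (s_arr x) (eb (s_arr x) (s_ix y) *
      (F (tgt (s_arr x)) (s_row y) (s_row x) * ed (s_arr x) (s_ix x))))
     else 0).
  apply: eq_bigr => y _; rewrite !mxE.
  by case: eqP => [->|]; rewrite ?mulr0 // !mulrA.
rewrite (sum_slots _ _ (fun a p s => if a == s_arr x then (-1) ^+ sg (s_arr x) *
   (tr (s_arr x) (Y (s_arr x) t s * ed (s_arr x) p) *
   tr (s_arr x) (eb (s_arr x) p * (F (tgt (s_arr x)) s (s_row x) * ed (s_arr x) (s_ix x))))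
     else 0)).
rewrite (bigD1 (s_arr x)) ?src_slot //= [X in _ + X]big1 ?addr0; last first.
  by move=> a /andP[_ /negPf->]; rewrite big1 // => p _; rewrite big1.
rewrite eqxx mxE exchange_big /= big_mkcond !mxE mulr_suml raddf_sum mulr_sumr.
apply: eq_bigr => s _; case: ifP => sm; last first.
  by rewrite (padded_row0 _ (gF _ (tgt_slot _)) sm) mulr0 mul0r raddf0 mulr0.
rewrite -mulr_sumr -[X in _ = _ * tr _ X]mulrA; congr (_ * _).
have zE : F (tgt (s_arr x)) s (s_row x) * ed (s_arr x) (s_ix x) \in ka (s_arr x).
  rewrite rpredM ?sp_ed_in //; apply: (subvP (sp_kv_tgt _)).
  exact: padded_in (gF _ (tgt_slot _)).
rewrite [in RHS](sp_expand zE) mulr_sumr raddf_sum.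
apply: eq_bigr => p _; rewrite [X in _ = tr _ X]mulrCA [RHS]sp_trZ 1?mulrC //.
by rewrite sp_tr_in // rpredM ?sp_eb_in.
Qed.

End VertexMatrices.

Section Families.
Variable N : nat.
Implicit Types (m : 'I_n -> nat) (Q X Y : sp_arrow P -> 'M[K]_N).
Implicit Types (F G : 'I_n -> 'M[K]_N) (a : sp_arrow P).

(** * Representations, bricks and cocycles in terms of matrices *)
Definition arrow_fam m X := forall a, padded (ka a) (m (tgt a)) (m (src a)) (X a).

Definition vertex_fam m F := forall i, padded (kv i) (m i) (m i) (F i).

Definition moment Y X i : 'M[K]_N :=
  \sum_(a | src a == i) (-1) ^+ sg a *: map_mx (tr a) (Y (opp a) *m X a).

Definition is_rep m Q := arrow_fam m Q /\ forall i, moment Q Q i = 0.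

Definition is_endo m Q F :=
  vertex_fam m F /\ forall a, F (tgt a) *m Q a = Q a *m F (src a).

(** In finite dimension a right inverse is two-sided, and the inverse of an
    endomorphism is an endomorphism; so this is invertibility of every nonzero
    element of the endomorphism ring. *)
Definition is_brick m Q :=
  (exists i, m i != 0%N) /\
  forall F, is_endo m Q F -> (exists i, F i != 0) ->
    exists G, vertex_fam m G /\ forall i, F i *m G i = pid_mx (m i).

(** X is a first order deformation of Q: Q + eps X solves the moment map equation
    modulo eps^2. *)
Definition is_cocycle m Q X :=
  arrow_fam m X /\ forall i, moment Q X i + moment X Q i = 0.

Definition is_rigid m Q := forall X, is_cocycle m Q X ->
  exists F, vertex_fam m F /\
    forall a, X a = F (tgt a) *m Q a - Q a *m F (src a).

Lemma padded_opp m X a : arrow_fam m X ->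
  padded (ka a) (m (src a)) (m (tgt a)) (X (opp a)).
Proof. by move=> gX; have := gX (opp a); rewrite sp_ka_opp sp_oppK. Qed.

Section AtVertex.
Variables (m : 'I_n -> nat) (i : 'I_n).
Local Notation D := #|slots N m i|.
Local Notation out_mx := (@out_mx N m i).
Local Notation in_mx := (@in_mx N m i).
Local Notation out_fam := (@out_fam N m i).
Local Notation in_fam := (@in_fam N m i).
Local Notation thru_prod := (@thru_prod N m i).
Local Notation nbr_mx := (@nbr_mx N m i).

Lemma tgt_neq a : src a = i -> tgt a != i.
Proof. by move=> <-; apply: sp_noloop. Qed.

(* m' is allowed to differ from m at i, since M~_i does not involve the dimension
   at i; the lemmas serve a representation and its reflection alike. *)
Section Away.
Variables (m' : 'I_n -> nat) (mm : forall j, j != i -> m' j = m j).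

Lemma padded_out X a : arrow_fam m' X -> src a = i ->
  padded (ka a) (m (tgt a)) (m' i) (X a).
Proof. by move=> gX sa; rewrite -(mm (tgt_neq sa)) -sa. Qed.

Lemma padded_into X a : arrow_fam m' X -> src a = i ->
  padded (ka a) (m' i) (m (tgt a)) (X (opp a)).
Proof. by move=> gX sa; rewrite -(mm (tgt_neq sa)) -sa; apply: padded_opp. Qed.

Lemma out_mx_inj X Y : arrow_fam m' X -> arrow_fam m' Y -> out_mx X = out_mx Y ->
  forall a, src a = i -> X a = Y a.
Proof.
move=> gX gY XY a sa.
by rewrite -(out_mxK sa (padded_out gX sa)) XY (out_mxK sa (padded_out gY sa)).
Qed.

Lemma in_mx_inj X Y : arrow_fam m' X -> arrow_fam m' Y ->
  in_mx (X \o opp) = in_mx (Y \o opp) -> forall a, tgt a = i -> X a = Y a.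
Proof.
move=> gX gY XY a ta.
have iX := @in_mxK N m i (X \o opp) _ _ ta (padded_into gX ta).
have iY := @in_mxK N m i (Y \o opp) _ _ ta (padded_into gY ta).
by move: iX iY; rewrite XY /= sp_oppK => -> ->.
Qed.

Lemma out_mx_pid X : arrow_fam m' X -> out_mx X *m pid_mx (m' i) = out_mx X.
Proof.
move=> gX; rewrite out_mx_mulr ?mxOver_pid //; apply: out_mx_ext => a sa.
exact: padded_r (padded_out gX sa).
Qed.

Lemma in_mx_pid X : arrow_fam m' X -> pid_mx (m' i) *m in_mx (X \o opp) = in_mx (X \o opp).
Proof.
move=> gX; rewrite in_mx_mull ?mxOver_pid //; apply: in_mx_ext => a sa.
exact: padded_l (padded_into gX sa).
Qed.

Lemma out_mx_over_fam X : arrow_fam m' X -> out_mx X \is a mxOver (kv i).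
Proof. by move=> gX; apply: out_mx_over => a /(padded_out gX)/padded_over. Qed.

Lemma in_mx_over_fam X : arrow_fam m' X -> in_mx (X \o opp) \is a mxOver (kv i).
Proof. by move=> gX; apply: in_mx_over => a /(padded_into gX)/padded_over. Qed.

Lemma moment_at Y X : arrow_fam m' X -> arrow_fam m' Y ->
  moment Y X i = in_mx (Y \o opp) *m out_mx X.
Proof.
move=> gX gY; rewrite in_out_mx // => a sa.
  by exists (m' i); apply: padded_into.
by exists (m' i); apply: padded_out.
Qed.

Lemma arrow_prod Y X a : arrow_fam m' X -> arrow_fam m' Y -> tgt a = i ->
  Y (opp a) *m X a = thru_prod (out_mx Y *m in_mx (X \o opp)) (opp a).
Proof.
move=> gX gY ta; rewrite -out_in_fam (out_mxK ta (padded_out gY ta)).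
by rewrite (@in_mxK N m i (X \o opp) _ _ ta (padded_into gX ta)) /= sp_oppK.
Qed.

Lemma nbr_out_fam F X : arrow_fam m' X ->
  nbr_mx F *m out_mx X = out_mx (fun a => F (tgt a) *m X a).
Proof. by move=> gX; apply: nbr_out_mx => a /(padded_out gX); exists (m' i). Qed.

Lemma in_nbr_fam F X : vertex_fam m' F ->
  in_mx (X \o opp) *m nbr_mx F = in_mx ((fun a => X a *m F (src a)) \o opp).
Proof.
by move=> gF; rewrite in_nbr_mx // => j ji; rewrite -(mm ji).
Qed.

Lemma out_mulr F X : vertex_fam m' F ->
  out_mx X *m F i = out_mx (fun a => X a *m F (src a)).
Proof.
by move=> gF; rewrite out_mx_mulr ?(padded_over (gF i)) //; apply: out_mx_ext => a ->.
Qed.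

Lemma in_mull F X : vertex_fam m' F ->
  F i *m in_mx (X \o opp) = in_mx ((fun a => F (tgt a) *m X a) \o opp).
Proof.
move=> gF; rewrite in_mx_mull ?(padded_over (gF i)) //; apply: in_mx_ext => a sa /=.
by rewrite sp_oppK sa.
Qed.

Lemma nbr_mx_over_fam F : vertex_fam m' F -> nbr_mx F \is a mxOver (kv i).
Proof. by move=> gF; apply: nbr_mx_over => j _; apply: padded_over (gF j). Qed.

(** The family that agrees with X away from i and has dO and dI as its maps out
    of and into i. *)
Definition glue X dO dI a : 'M[K]_N :=
  if src a == i then out_fam dO a else if tgt a == i then in_fam dI (opp a) else X a.

Lemma glue_away X dO dI a : src a != i -> tgt a != i -> glue X dO dI a = X a.
Proof. by rewrite /glue => /negPf-> /negPf->. Qed.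

Lemma glue_out X dO dI : dO \is a mxOver (kv i) -> out_mx (glue X dO dI) = dO.
Proof.
by move=> dE; rewrite -[RHS](out_famK dE); apply: out_mx_ext => a sa; rewrite /glue sa eqxx.
Qed.

Lemma glue_in X dO dI : dI \is a mxOver (kv i) ->
  in_mx (glue X dO dI \o opp) = dI.
Proof.
move=> dE; rewrite -[RHS](in_famK dE); apply: in_mx_ext => a sa /=.
by rewrite /glue (negPf (tgt_neq sa)) sp_oppK sa eqxx.
Qed.

Lemma glue_padded X dO dI : arrow_fam m X ->
  dO \is a mxOver (kv i) -> dI \is a mxOver (kv i) ->
  dO *m pid_mx (m' i) = dO -> pid_mx (m' i) *m dI = dI ->
  arrow_fam m' (glue X dO dI).
Proof.
move=> gX OE IE Oe eI a; rewrite /glue; case: eqP => [sa|/eqP sa].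
  by rewrite sa (mm (tgt_neq sa)); apply: out_fam_padded.
case: eqP => [ta|/eqP ta]; last by rewrite !mm.
have := @in_fam_padded N m i dI (m' i) _ ta IE eI.
by rewrite sp_ka_opp sp_oppK ta (mm sa).
Qed.

End Away.
End AtVertex.

End Families.

Section Transfer.
Variable N : nat.
Implicit Types (m : 'I_n -> nat) (Q X Y : sp_arrow P -> 'M[K]_N).
Implicit Types (F G : 'I_n -> 'M[K]_N) (a : sp_arrow P).

(** * Reflection at a vertex *)

(* Q has the maps O and I at i, its reflection Q' has O' and I', and
   0 -> M_i -> M~_i -> M'_i -> 0 is exact by O and I', split by R and S.  The two
   composites on M~_i agree. *)
Section Reflection.
Variables (m m' : 'I_n -> nat) (i : 'I_n) (Q Q' : sp_arrow P -> 'M[K]_N).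
Local Notation D := #|slots N m i|.
Variables (R : 'M[K]_(N, D)) (S : 'M[K]_(D, N)).
Local Notation out_mx := (@out_mx N m i).
Local Notation in_mx := (@in_mx N m i).
Local Notation nbr_mx := (@nbr_mx N m i).
Local Notation glue := (@glue N m i).

Hypothesis hQ : is_rep m Q.
Hypothesis hQ' : is_rep m' Q'.
Hypothesis mm : forall j, j != i -> m' j = m j.
Hypothesis QQ : forall a, src a != i -> tgt a != i -> Q' a = Q a.
Hypothesis RE : R \is a mxOver (kv i).
Hypothesis SE : S \is a mxOver (kv i).
Let O := out_mx Q.
Let I := in_mx (Q \o opp).
Let O' := out_mx Q'.
Let I' := in_mx (Q' \o opp).
Hypothesis RO : R *m O = pid_mx (m i).
Hypothesis eR : pid_mx (m i) *m R = R.
Hypothesis IO' : I' *m O = 0.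
Hypothesis IS : I' *m S = pid_mx (m' i).
Hypothesis Se : S *m pid_mx (m' i) = S.
Hypothesis OR : O *m R + S *m I' = 1%:M.
Hypothesis OI : O' *m I' = O *m I.

Let mm0 : forall j, j != i -> m j = m j. Proof. by []. Qed.
Let gQ : arrow_fam m Q := hQ.1.
Let gQ' : arrow_fam m' Q' := hQ'.1.

Let IO0 : I *m O = 0.
Proof. by rewrite -(moment_at mm0 gQ gQ) hQ.2. Qed.

Let IO0' : I' *m O' = 0.
Proof. by rewrite -(moment_at mm gQ' gQ') hQ'.2. Qed.

Let Oe : O *m pid_mx (m i) = O. Proof. exact: out_mx_pid. Qed.
Let Oe' : O' *m pid_mx (m' i) = O'. Proof. exact: out_mx_pid. Qed.
Let eI : pid_mx (m i) *m I = I. Proof. exact: in_mx_pid. Qed.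
Let eI' : pid_mx (m' i) *m I' = I'. Proof. exact: in_mx_pid. Qed.
Let OE : O \is a mxOver (kv i). Proof. exact: out_mx_over_fam gQ. Qed.
Let OE' : O' \is a mxOver (kv i). Proof. exact: out_mx_over_fam gQ'. Qed.
Let IE : I \is a mxOver (kv i). Proof. exact: in_mx_over_fam gQ. Qed.
Let IE' : I' \is a mxOver (kv i). Proof. exact: in_mx_over_fam gQ'. Qed.

Definition put F (A : 'M[K]_N) j := if j == i then A else F j.

Lemma put_at F A : put F A i = A. Proof. by rewrite /put eqxx. Qed.
Lemma put_away F A j : j != i -> put F A j = F j.
Proof. by rewrite /put => /negPf->. Qed.

Lemma put_padded F A : vertex_fam m' F -> padded (kv i) (m i) (m i) A ->
  vertex_fam m (put F A).
Proof.
move=> gF gA j; rewrite /put; case: eqP => [->//|/eqP ji].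
by rewrite -(mm ji).
Qed.

Lemma arrow_fam_mull F X : vertex_fam m F -> arrow_fam m X ->
  arrow_fam m (fun a => F (tgt a) *m X a).
Proof.
move=> gF gX a; apply: paddedM (gX a).
exact: padded_sub (sp_kv_tgt a) (gF _).
Qed.

Lemma arrow_fam_mulr F X : vertex_fam m F -> arrow_fam m X ->
  arrow_fam m (fun a => X a *m F (src a)).
Proof.
move=> gF gX a; apply: paddedM (gX a) _.
exact: padded_sub (sp_kv_sub a) (gF _).
Qed.

Lemma arrow_famB X Y : arrow_fam m X -> arrow_fam m Y ->
  arrow_fam m (fun a => X a - Y a).
Proof. by move=> gX gY a; apply: paddedD => //; apply: paddedN. Qed.

Lemma nbr_mx_put F A : nbr_mx (put F A) = nbr_mx F.
Proof. by apply: nbr_mx_ext => j ji; rewrite put_away. Qed.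

(** An endomorphism F of Q' preserves the kernel of I', which is the image of O,
    so that F acts on M_i by A = R F~ O, where F~ is its action on M~_i; this gives an
    endomorphism of Q.  Its inverse induces in turn an inverse of F on the
    quotient M'_i. *)
Lemma brick_reflect : is_brick m Q -> (exists j, m' j != 0%N) -> is_brick m' Q'.
Proof.
move=> [_ bQ] nz'; split=> // F [gF eF] nzF.
set T := nbr_mx F.
have TO' : T *m O' = O' *m F i.
  by rewrite (nbr_out_fam mm _) // (out_mulr _ _ _ gF); apply: out_mx_ext => a _.
have TI' : F i *m I' = I' *m T.
  by rewrite (in_mull _ _ _ gF) (in_nbr_fam mm _ gF); apply: in_mx_ext => a _ /=.
have TE : T \is a mxOver (kv i) by apply: nbr_mx_over_fam gF.
pose A := R *m T *m O.
have gA : padded (kv i) (m i) (m i) A.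
  apply: paddedP; first by rewrite !mxOverM.
    by rewrite /A !mulmxA eR.
  by rewrite /A -!mulmxA Oe.
have ITO : I' *m T *m O = 0 by rewrite -TI' -mulmxA IO' mulmx0.
have TO : T *m O = O *m A.
  rewrite -[LHS]mul1mx -OR mulmxDl -[S *m I' *m _]mulmxA [I' *m _]mulmxA ITO.
  by rewrite mulmx0 addr0 /A !mulmxA.
clearbody A.
(* O is injective, so this may be checked after composing with O. *)
have TI : A *m I = I *m T.
  have OO : O *m (A *m I) = O *m (I *m T).
    by rewrite mulmxA -TO -mulmxA -OI mulmxA TO' -mulmxA TI' !mulmxA OI.
  have := congr1 (mulmx R) OO; rewrite !mulmxA RO (padded_l gA) => ->.
  by rewrite eI.
pose G := put F A.
have gG : vertex_fam m G by apply: put_padded.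
have eG : is_endo m Q G.
  split=> // a; case: (eqVneq (src a) i) => [sa|sa].
    apply: (out_mx_inj mm0 (arrow_fam_mull gG gQ) (arrow_fam_mulr gG gQ)) => //.
    by rewrite -(out_mulr _ _ _ gG) -(nbr_out_fam mm0 _) // /G nbr_mx_put put_at.
  case: (eqVneq (tgt a) i) => [ta|ta].
    apply: (in_mx_inj mm0 (arrow_fam_mull gG gQ) (arrow_fam_mulr gG gQ)) => //.
    by rewrite -(in_mull _ _ _ gG) -(in_nbr_fam mm0 _ gG) /G nbr_mx_put put_at.
  by rewrite /G !put_away // -QQ // eF.
(* If G vanishes then so does T, and F i is recovered from T since I' is onto. *)
have nzG : exists j, G j != 0.
  apply: contrapT => G0; have G0' j : G j = 0.
    by apply/eqP; apply: contrapT => /negP h; apply: G0; exists j.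
  have T0 : T = 0.
    apply/matrixP=> x y; rewrite /T -(nbr_mx_put F A) !mxE; case: ifP => // _.
    by rewrite -/G G0' mxE mulr0 mul0r raddf0.
  case: nzF => j; case: (eqVneq j i) => [->|ji]; last first.
    by have := G0' j; rewrite /G put_away // => ->; rewrite eqxx.
  by rewrite -(padded_r (gF i)) -IS mulmxA TI' T0 mulmx0 mul0mx eqxx.
have [H [gH GH]] := bQ G eG nzG.
pose B := I' *m nbr_mx H *m S.
have HE : nbr_mx H \is a mxOver (kv i) by apply: nbr_mx_over_fam gH.
exists (put H B); split.
  move=> j; rewrite /put; case: eqP => [->|/eqP ji]; last by rewrite mm.
  apply: paddedP; first by rewrite !mxOverM.
    by rewrite /B !mulmxA eI'.
  by rewrite /B -!mulmxA Se.
move=> j; rewrite /put; case: eqP => [->|/eqP ji]; last first.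
  by rewrite mm // -GH /G put_away.
rewrite /B !mulmxA TI' -IS; congr (_ *m S).
have gHF : forall j, j != i -> padded (kv j) (m j) (m j) (F j).
  by move=> l li; rewrite -(mm li).
rewrite /I' /T in_nbr_mx // in_nbr_mx; last by move=> l _; apply: gH.
apply: in_mx_ext => a sa /=.
have ts := tgt_neq sa.
rewrite -mulmxA; have := GH (tgt a); rewrite /G put_away // => ->.
by rewrite -(mm ts) (padded_r (padded_opp a gQ')).
Qed.

(** A first order deformation of Q deforms the image of O, hence also its
    cokernel, and so yields a deformation X' of Q' with the same deformation
    of O I.  A trivialization F of X' yields one of X: away from i it is F, and
    at i it is the map induced on the image of O. *)
Lemma rigid_reflect : is_rigid m' Q' -> is_rigid m Q.
Proof.
move=> rig X [gX cX].
set dO := out_mx X; set dI := in_mx (X \o opp).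
have dOE : dO \is a mxOver (kv i) by apply: out_mx_over_fam gX.
have dIE : dI \is a mxOver (kv i) by apply: in_mx_over_fam gX.
have dOe : dO *m pid_mx (m i) = dO by apply: out_mx_pid.
have edI : pid_mx (m i) *m dI = dI by apply: in_mx_pid.
have cyc : I *m dO + dI *m O = 0.
  by rewrite -(cX i) (moment_at mm0 gX gQ) (moment_at mm0 gQ gX).
have [dT dTD] : exists Z, Z = O *m dI + dO *m I by eexists.
(* Solves dI' O + I' dO = 0, so that the deformed I' still kills the deformed O. *)
have [dI' dI'D] : exists Z, Z = - (I' *m dO *m R) by eexists.
(* Solves O' dI' + dO' I' = dT; this is possible because dT - O' dI' kills the
   image of O. *)
have [dO' dO'D] : exists Z, Z = (dT - O' *m dI') *m S by eexists.
have dTE : dT \is a mxOver (kv i) by rewrite dTD rpredD ?mxOverM.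
have dIE' : dI' \is a mxOver (kv i) by rewrite dI'D rpredN !mxOverM.
have dOE' : dO' \is a mxOver (kv i).
  by rewrite dO'D mxOverM // rpredB // mxOverM.
have dIO : dI' *m O = - (I' *m dO).
  by rewrite dI'D mulNmx -!mulmxA RO dOe.
have dTO : (dT - O' *m dI') *m O = 0.
  rewrite mulmxBl -[O' *m dI' *m _]mulmxA dIO mulmxN mulmxA OI opprK.
  rewrite dTD mulmxDl -[dO *m I *m _]mulmxA IO0 mulmx0 addr0 -mulmxA -[O *m I *m _]mulmxA.
  by rewrite -mulmxDr addrC cyc mulmx0.
have dOI' : dO' *m I' = dT - O' *m dI'.
  rewrite -[RHS]mulmx1 -OR mulmxDr [(_ - _) *m (O *m R)]mulmxA dTO mul0mx add0r.
  by rewrite dO'D mulmxA.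
have dTs : O' *m dI' + dO' *m I' = dT by rewrite dOI' addrC subrK.
have dOe' : dO' *m pid_mx (m' i) = dO' by rewrite dO'D -mulmxA Se.
have edI' : pid_mx (m' i) *m dI' = dI' by rewrite dI'D mulmxN !mulmxA eI'.
have cyc' : I' *m dO' + dI' *m O' = 0.
  have h : (I' *m dO' + dI' *m O') *m I' = 0.
    rewrite mulmxDl -!mulmxA dOI' OI mulmxBr [I' *m (O' *m _)]mulmxA IO0' mul0mx subr0.
    rewrite dTD mulmxDr [I' *m (O *m _)]mulmxA IO' mul0mx add0r !mulmxA dIO mulNmx.
    by rewrite subrr.
  have := congr1 (fun Z => Z *m S) h; rewrite mul0mx -mulmxA IS => h'.
  by rewrite -[RHS]h' mulmxDl -!mulmxA dOe' Oe'.
pose X' := glue X dO' dI'.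
have gX' : arrow_fam m' X' by apply: glue_padded.
have oX' : out_mx X' = dO' by rewrite glue_out.
have iX' : in_mx (X' \o opp) = dI' by rewrite glue_in.
have [|F [gF eF]] := rig X'.
  split=> // j; case: (eqVneq j i) => [->|ji].
    by rewrite (moment_at mm gX' gQ') (moment_at mm gQ' gX') oX' iX' cyc'.
  rewrite -[RHS](cX j) /moment -!big_split; apply: eq_bigr => a /eqP sa /=.
  rewrite -!scalerDr; congr (_ *: _).
  rewrite -!raddfD /=; congr (map_mx _ _).
  have sai : src a != i by rewrite sa.
  case: (eqVneq (tgt a) i) => ta; last first.
    by rewrite /X' !glue_away ?sp_oppK // !QQ ?sp_oppK.
  rewrite (arrow_prod mm gX' gQ' ta) (arrow_prod mm gQ' gX' ta).
  rewrite (arrow_prod mm0 gX gQ ta) (arrow_prod mm0 gQ gX ta) -!thru_prodD.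
  by rewrite oX' iX' dTs dTD.
set T := nbr_mx F.
have dOE1 : dO' = T *m O' - O' *m F i.
  rewrite -oX' (nbr_out_fam mm _) // (out_mulr _ _ _ gF) -out_mxB.
  by apply: out_mx_ext => a _; rewrite eF.
have dIE1 : dI' = F i *m I' - I' *m T.
  rewrite -iX' (in_nbr_fam mm _ gF) (in_mull _ _ _ gF) -in_mxB.
  by apply: in_mx_ext => a _; rewrite /= eF.
have TE : T \is a mxOver (kv i) by apply: nbr_mx_over_fam gF.
(* T O - dO takes values in the image of O, being killed by I'. *)
pose A := R *m (T *m O - dO).
have gA : padded (kv i) (m i) (m i) A.
  apply: paddedP; first by rewrite mxOverM // rpredB // mxOverM.
    by rewrite mulmxA eR.
  by rewrite -mulmxA mulmxBl dOe -mulmxA Oe.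
have dO2 : dO = T *m O - O *m A.
  have h : I' *m (T *m O - dO) = 0.
    have := dIO; rewrite dIE1 mulmxBl -mulmxA IO' mulmx0 sub0r => /oppr_inj h.
    by rewrite mulmxBr mulmxA h subrr.
  have -> : O *m A = T *m O - dO.
    by rewrite -[RHS]mul1mx -OR mulmxDl -[S *m I' *m _]mulmxA h mulmx0 addr0 mulmxA.
  by rewrite opprB addrC subrK.
clearbody A.
have dI2 : dI = A *m I - I *m T.
  have dTE1 : O *m dI + dO *m I = T *m O *m I - O *m I *m T.
    rewrite -dTD -dTs {1}dIE1 dOE1 mulmxBl mulmxBr !mulmxA.
    rewrite -[T *m O' *m I']mulmxA -[O' *m F i *m I']mulmxA OI.
    by rewrite addrC addrA subrK mulmxA.
  have h : O *m dI = O *m (A *m I - I *m T).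
    apply: (addIr (dO *m I)); rewrite dTE1 dO2 mulmxBr mulmxBl !mulmxA.
    by rewrite [RHS]addrC addrA subrK.
  have := congr1 (mulmx R) h; rewrite !mulmxA RO edI => ->.
  by rewrite mulmxBr !mulmxA (padded_l gA) eI.
pose G := put F A.
have gG : vertex_fam m G by apply: put_padded.
have gB : arrow_fam m (fun a => G (tgt a) *m Q a - Q a *m G (src a)).
  by apply: arrow_famB; [apply: arrow_fam_mull | apply: arrow_fam_mulr].
exists G; split=> // a; case: (eqVneq (src a) i) => [sa|sa].
  apply: (out_mx_inj mm0 gX gB) => //; rewrite out_mxB -(out_mulr _ _ _ gG).
  by rewrite -(nbr_out_fam mm0 _) // /G nbr_mx_put put_at.
case: (eqVneq (tgt a) i) => [ta|ta].
  apply: (in_mx_inj mm0 gX gB) => //.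
  rewrite -[RHS]/(in_mx (fun b => (G (src (opp (opp b))) *m Q (opp b))
                              - (Q (opp b) *m G (src (opp b))))) in_mxB.
  have := in_mull m i Q gG; have := in_nbr_fam mm0 Q gG.
  by rewrite /comp /= => <- <-; rewrite /G nbr_mx_put put_at.
by have := eF a; rewrite /X' /G glue_away // !QQ // !put_away.
Qed.

End Reflection.
End Transfer.

Section Induction.
Variable N : nat.
Implicit Types (m : 'I_n -> nat) (Q X Y : sp_arrow P -> 'M[K]_N).
Implicit Types (F G : 'I_n -> 'M[K]_N) (a : sp_arrow P).

(** * Induction on the dimension of a brick *)

(** No copy of the simple representation at i lies in Q. *)
Definition out_inj m Q i := forall v : 'cV[K]_N,
  v \is a mxOver (kv i) -> pid_mx (m i) *m v = v ->
  (forall a, src a = i -> Q a *m v = 0) -> v = 0.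

(** The dimension of M~_i over the field of i. *)
Definition nbr_dim m i := (\sum_(a | src a == i) rk a * m (tgt a))%N.

(** [out_mx_mulr] is about square matrices, so the column v is repeated to make
    one. *)
Lemma out_mx_ker m Q i (v : 'cV[K]_N) : arrow_fam m Q ->
  v \is a mxOver (kv i) -> pid_mx (m i) *m v = v -> out_mx m i Q *m v = 0 ->
  forall a, src a = i -> Q a *m v = 0.
Proof.
move=> gQ vE ev Ov a sa.
pose A : 'M[K]_N := v *m const_mx 1.
have AE : A \is a mxOver (kv i).
  by rewrite mxOverM //; apply/mxOverP=> x y; rewrite mxE rpred1.
have QA : Q a *m A = 0.
  have gQA : padded (ka a) (m (tgt a)) N (Q a *m A).
    apply: paddedM (gQ a) _; apply: paddedP.
    - by apply: mxOverS AE; rewrite -sa; apply/subvP/sp_kv_sub.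
    - by rewrite mulmxA sa ev.
    - by rewrite pid_mx_1 mulmx1.
  rewrite -(@out_mxK N m i (fun a => Q a *m A) N a sa gQA).
  rewrite -out_mx_mulr // mulmxA Ov mul0mx.
  by apply/matrixP=> s t; rewrite !mxE big1 // => x _; rewrite mxE mulr0.
apply/matrixP=> s t; have /matrixP/(_ s s) := QA.
rewrite mulmxA mxE big_ord1 [const_mx 1 _ _]mxE.
rewrite mulr1 [X in _ = X -> _]mxE [t]ord1 [X in _ -> _ = X]mxE => <-.
by congr (_ s _); rewrite [LHS]ord1 [RHS]ord1.
Qed.

(** The bound on [nbr_dim m i] makes the dimension at i decrease, which keeps it
    at most N. *)
Lemma reflect_exists m Q i : (forall j, m j <= N)%N -> is_rep m Q ->
  out_inj m Q i -> (nbr_dim m i < 2 * m i)%N ->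
  exists m' Q', [/\ is_rep m' Q',
    (forall j, m' j <= N)%N /\ (forall j, j != i -> m' j = m j),
    (m' i + m i)%N = nbr_dim m i,
    is_brick m Q -> (exists j, m' j != 0%N) -> is_brick m' Q' &
    is_rigid m' Q' -> is_rigid m Q].
Proof.
move=> mN hQ inj small; have gQ := hQ.1.
have mm0 : forall j, j != i -> m j = m j by [].
have Dc : #|slots N m i| = nbr_dim m i by apply: card_slots.
set D := #|_| in Dc.
set O := out_mx m i Q; set I := in_mx m i (Q \o opp).
have IO : I *m O = 0 by rewrite -(moment_at mm0 gQ gQ) hQ.2.
have OE : O \is a mxOver (kv i) by apply: out_mx_over_fam gQ.
have IE : I \is a mxOver (kv i) by apply: in_mx_over_fam gQ.
have DN : (D - m i <= N)%N.
  by rewrite Dc (leq_trans _ (mN i)) // leq_subLR addnn -mul2n ltnW.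
have Oe : O *m pid_mx (m i) = O by apply: out_mx_pid.
have Oinj (v : 'cV[K]_N) : v \is a mxOver (kv i) -> pid_mx (m i) *m v = v ->
    O *m v = 0 -> v = 0.
  by move=> vE ev Ov; apply: inj => //; apply: out_mx_ker Ov.
have [lemD [R [S [J [[RE SE JE] [RO eR JO JS] eJ Se OR]]]]] :=
  split_injective_mxOver OE (mN i) Oe Oinj DN.
pose m' j := if j == i then (D - m i)%N else m j.
have mi' : m' i = (D - m i)%N by rewrite /m' eqxx.
have mm : forall j, j != i -> m' j = m j by move=> j; rewrite /m' => /negPf->.
rewrite -mi' in eJ Se JS.
have OE' : O *m I *m S \is a mxOver (kv i) by rewrite !mxOverM.
pose Q' := glue Q (O *m I *m S) J.
have QQ : forall a, src a != i -> tgt a != i -> Q' a = Q a.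
  by move=> a; apply: glue_away.
have gQ' : arrow_fam m' Q' by apply: glue_padded => //; rewrite -!mulmxA Se.
have oQ' : out_mx m i Q' = O *m I *m S by rewrite glue_out.
have iQ' : in_mx m i (Q' \o opp) = J by rewrite glue_in.
have OI : out_mx m i Q' *m in_mx m i (Q' \o opp) = O *m I.
  rewrite oQ' iQ' -mulmxA -[RHS]mulmx1 -OR mulmxDr [in RHS]mulmxA.
  by rewrite -[O *m I *m O]mulmxA IO mulmx0 mul0mx add0r.
have hQ' : is_rep m' Q'.
  split=> // j; case: (eqVneq j i) => [->|ji].
    by rewrite (moment_at mm gQ' gQ') oQ' iQ' !mulmxA JO !mul0mx.
  rewrite -[RHS](hQ.2 j); apply: eq_bigr => a /eqP sa; congr (_ *: map_mx _ _).
  have sai : src a != i by rewrite sa.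
  case: (eqVneq (tgt a) i) => ta; last by rewrite !QQ ?sp_oppK.
  by rewrite (arrow_prod mm gQ' gQ' ta) (arrow_prod mm0 gQ gQ ta) OI.
exists m', Q'; split=> //.
- by split=> // j; rewrite /m'; case: ifP.
- by rewrite mi' -Dc subnK.
- by apply: (@brick_reflect N m m' i Q Q' R S); rewrite ?OI ?iQ'.
- by apply: (@rigid_reflect N m m' i Q Q' R S); rewrite ?OI ?iQ'.
Qed.

(** The dual representation; by the symmetry of the moment map under transposition
    it is a representation of the same algebra. *)
Definition transp Q a : 'M[K]_N := (Q (opp a))^T.

Lemma transp_padded m Q : arrow_fam m Q -> arrow_fam m (transp Q).
Proof. by move=> gQ a; apply: paddedT; apply: padded_opp. Qed.

Lemma vertex_famT m F : vertex_fam m F -> vertex_fam m (fun j => (F j)^T).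
Proof. by move=> gF j; apply: paddedT. Qed.

Lemma moment_transp Y X i : moment (transp Y) (transp X) i = (moment X Y i)^T.
Proof.
rewrite raddf_sum; apply: eq_bigr => a _ /=.
rewrite /transp sp_oppK -trmx_mul; move: (X _ *m _) => Z.
by apply/matrixP=> s t; rewrite !mxE.
Qed.

Lemma rep_transp m Q : is_rep m Q -> is_rep m (transp Q).
Proof.
case=> gQ hQ; split; first exact: transp_padded.
by move=> i; rewrite moment_transp hQ trmx0.
Qed.

Lemma brick_transp m Q : is_brick m Q -> is_brick m (transp Q).
Proof.
case=> nz bQ; split=> // F [gF eF] [j nzF].
have [||G [gG FG]] := bQ (fun j => (F j)^T).
- split; first exact: vertex_famT.
  move=> a; have := congr1 trmx (eF (opp a)).
  by rewrite /transp !trmx_mul sp_oppK trmxK => ->.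
- by exists j; apply: contra nzF => /eqP/(congr1 trmx); rewrite trmxK trmx0 => ->.
exists (fun j => (G j)^T); split; first exact: vertex_famT.
move=> l; rewrite -[F l]trmxK -trmx_mul.
by rewrite (padded_mulC (vertex_famT gF l) (gG l) (FG l)) tr_pid_mx.
Qed.

(** The trivialization changes sign because transposition reverses the order in
    F Q - Q F. *)
Lemma rigid_transp m Q : is_rigid m (transp Q) -> is_rigid m Q.
Proof.
move=> rQ X [gX cX]; have [|F [gF eF]] := rQ (transp X).
  split; first exact: transp_padded.
  by move=> i; rewrite !moment_transp -raddfD addrC cX raddf0.
exists (fun j => - (F j)^T); split.
  by move=> j; apply: paddedN; apply: vertex_famT.
move=> a; have := congr1 trmx (eF (opp a)).
rewrite /transp !sp_oppK raddfB /= !trmx_mul !trmxK => ->.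
by rewrite mulNmx mulmxN opprK addrC.
Qed.

(** A vector v in the kernel of out and a covector u vanishing on the image of in
    give the endomorphism v u^T concentrated at i.  In a brick it is invertible,
    which leaves room for one dimension only. *)
Lemma brick_out_inj m Q i : (forall j, m j <= N)%N -> is_brick m Q ->
  out_inj m Q i \/ out_inj m (transp Q) i \/ forall j, m j = (j == i).
Proof.
move=> mN [nz bQ].
case: (pselect (out_inj m Q i)) => [|/existsNP[v]]; first by left.
move=> /not_implyP[vE /not_implyP[ev /not_implyP[Qv /eqP v0]]].
case: (pselect (out_inj m (transp Q) i)) => [|/existsNP[u]]; first by right; left.
move=> /not_implyP[uE /not_implyP[eu /not_implyP[Qu /eqP u0]]].
right; right.
pose F j : 'M[K]_N := if j == i then v *m u^T else 0.
have FE : is_endo m Q F.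
  split=> [j|a].
    rewrite /F; case: eqP => [->|_]; last exact: padded0.
    apply: paddedP.
    - rewrite mxOverM //; apply/mxOverP=> x y; rewrite mxE.
      exact: (mxOverP uE).
    - by rewrite mulmxA ev.
    - by rewrite -mulmxA -[pid_mx _]trmxK tr_pid_mx -trmx_mul eu.
  rewrite /F; case: (eqVneq (src a) i) => [sa|sa].
    have /negPf-> : tgt a != i by rewrite -sa sp_noloop.
    by rewrite mul0mx mulmxA Qv // mul0mx.
  rewrite mulmx0; case: eqP => [ta|]; last by rewrite mul0mx.
  have := congr1 trmx (Qu _ ta); rewrite /transp sp_oppK trmx_mul trmxK trmx0.
  by rewrite -mulmxA => ->; rewrite mulmx0.
have FN : exists j, F j != 0.
  exists i; rewrite /F eqxx; apply/eqP => /matrixP vu.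
  have [s vs] : exists s, v s 0 != 0.
    apply: contrapT => h; case/eqP: v0; apply/matrixP=> s t.
    by rewrite ord1 mxE; apply/eqP; apply: contrapT => /negP vs; apply: h; exists s.
  have [t ut] : exists t, u t 0 != 0.
    apply: contrapT => h; case/eqP: u0; apply/matrixP=> t z.
    by rewrite ord1 mxE; apply/eqP; apply: contrapT => /negP ut; apply: h; exists t.
  have := vu s t; rewrite !mxE big_ord1 mxE => /eqP; rewrite mulf_eq0.
  by rewrite (negPf vs) (negPf ut).
have [G [gG FG]] := bQ F FE FN.
move=> j; have := congr1 mxrank (FG j).
rewrite rank_pid_mx ?mN // /F; case: eqP => [->|_]; last first.
  by rewrite mul0mx mxrank0.
move=> h; apply/eqP; rewrite eqn_leq -{1}h -mulmxA.
rewrite (leq_trans (mxrankM_maxl _ _)) ?rank_leq_col //= lt0n.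
by apply: contra v0 => /eqP m0; rewrite -ev m0 pid_mx_0 mul0mx.
Qed.

Lemma simple_rigid m Q i : (forall j, m j = (j == i)) -> is_rigid m Q.
Proof.
move=> m1 X [gX _]; exists (fun=> 0); split=> [j|a]; first exact: padded0.
rewrite mul0mx mulmx0 subr0; have := gX a; rewrite !m1.
case: (eqVneq (src a) i) => [sa|sa].
  have /negPf-> : tgt a != i by rewrite -sa sp_noloop.
  by move/padded_l <-; rewrite pid_mx_0 mul0mx.
by move/padded_r <-; rewrite pid_mx_0 mulmx0.
Qed.

(** T stands for positivity of the norm and Pr for being a real root;
    both enter only through their behaviour under reflections. *)
Lemma brick_induction (T Pr : ('I_n -> nat) -> Prop) :
  (forall m, T m -> exists i, nbr_dim m i < 2 * m i)%N ->
  (forall i m m', (forall j, j != i -> m' j = m j) ->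
     (m' i + m i)%N = nbr_dim m i -> T m -> T m') ->
  (forall i m m', (forall j, j != i -> m' j = m j) ->
     (m' i + m i)%N = nbr_dim m i -> Pr m' -> Pr m) ->
  (forall i m, (forall j, m j = (j == i)) -> Pr m) ->
  forall m Q, (forall j, m j <= N)%N -> is_rep m Q -> is_brick m Q -> T m ->
  Pr m /\ is_rigid m Q.
Proof.
move=> Tpos Tr Prr Pr1 m; have [s] := ubnP (\sum_j m j)%N.
elim: s m => // s IHs m /ltnSE sm Q mN hQ bQ Tm.
have [i small] := Tpos _ Tm.
(* When in rather than out is the good map, pass to the transpose. *)
wlog inj : Q hQ bQ / out_inj m Q i.
  move=> gen; case: (brick_out_inj i mN bQ) => [|[inj|m1]]; first exact: gen.
    have [? rQ] := gen _ (rep_transp hQ) (brick_transp bQ) inj.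
    by split=> //; apply: rigid_transp.
  by split; [apply: Pr1 m1 | apply: simple_rigid m1].
have [m' [Q' [hQ' [mN' mm] mi brk rig]]] := reflect_exists mN hQ inj small.
have Tm' := Tr _ _ _ mm mi Tm.
have nz : exists j, m' j != 0%N.
  have [j jpos] := Tpos _ Tm'; exists j; apply: contraTneq jpos => ->.
  by rewrite muln0.
have lt : (\sum_j m' j < s)%N.
  apply: leq_trans sm; rewrite (bigD1 i) //= [X in (_ < X)%N](bigD1 i) //=.
  rewrite (eq_bigr m) //; rewrite ltn_add2r -(ltn_add2r (m i)) mi.
  by rewrite addnn -mul2n.
have [Pm' rm'] := IHs _ lt _ mN' hQ' (brk bQ nz) Tm'.
by split; [apply: Prr mm mi Pm' | apply: rig].
Qed.

End Induction.

(** * Counting dimensions for a rigid representation *)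
Section FfunSpace.
Variables (I : finType) (vT : vectType k) (U : I -> {vspace vT}).

Definition ffun_at (i : I) (x : vT) : {ffun I -> vT} :=
  [ffun j => if j == i then x else 0].

Fact ffun_at_linear i : linear (ffun_at i).
Proof.
move=> c x y; apply/ffunP=> j; rewrite !ffunE.
by case: ifP; rewrite ?scaler0 ?addr0.
Qed.
HB.instance Definition _ i :=
  GRing.isLinear.Build k vT {ffun I -> vT} *:%R (ffun_at i) (ffun_at_linear i).

Definition ffun_space : {vspace {ffun I -> vT}} :=
  (\sum_i (linfun (ffun_at i) @: U i))%VS.

Lemma ffun_sum_at (f : I -> vT) : \sum_i ffun_at i (f i) = [ffun i => f i].
Proof.
apply/ffunP=> j; rewrite sum_ffunE ffunE (bigD1 j) //= ffunE eqxx big1 ?addr0 //.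
by move=> i ij; rewrite ffunE eq_sym (negPf ij).
Qed.

Lemma ffun_spaceP (f : {ffun I -> vT}) :
  reflect (forall i, f i \in U i) (f \in ffun_space).
Proof.
apply: (iffP idP) => [/memv_sumP[g gU ->] i|fU].
  rewrite sum_ffunE rpred_sum // => j _.
  have /memv_imgP[x xU ->] := gU j isT; rewrite lfunE ffunE.
  by case: eqP => [->//|_]; rewrite mem0v.
have -> : f = \sum_i ffun_at i (f i).
  by rewrite ffun_sum_at; apply/ffunP=> i; rewrite ffunE.
apply: memv_sumr => i _; have := memv_img (linfun (ffun_at i)) (fU i).
by rewrite lfunE.
Qed.

Lemma dim_ffun_space : \dim ffun_space = (\sum_i \dim (U i))%N.
Proof.
have /directvP-> : directv (\sum_i (linfun (ffun_at i) @: U i)).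
  apply/directv_sum_independent => us usU us0 i _.
  have /memv_imgP[x xU ux] := usU i isT.
  have : (\sum_j us j) i = 0 by rewrite us0 ffunE.
  rewrite sum_ffunE (bigD1 i) //= big1 ?addr0 => [|j ji]; last first.
    have /memv_imgP[y yU ->] := usU j isT.
    by rewrite lfunE ffunE eq_sym (negPf ji).
  by rewrite ux lfunE ffunE eqxx => ->; rewrite raddf0.
apply: eq_bigr => i _; apply: limg_dim_eq; apply/eqP; rewrite -subv0.
apply/subvP=> x; rewrite memv_cap memv_ker lfunE => /andP[_ /eqP/ffunP/(_ i)].
by rewrite !ffunE eqxx => ->; rewrite mem0v.
Qed.

End FfunSpace.

Section DimensionCount.
Variables (N : nat) (m : 'I_n -> nat) (Q : sp_arrow P -> 'M[K]_N).
Hypothesis mN : forall j, (m j <= N)%N.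
Hypothesis gQ : arrow_fam m Q.
Local Notation C0 := {ffun 'I_n * ('I_N * 'I_N) -> K}.
Local Notation C1 := {ffun sp_arrow P * ('I_N * 'I_N) -> K}.

(** Families of matrices are stored as finite functions to K, since these form a
    vector space over k. *)
Definition ffun_mx (J : finType) (f : {ffun J * ('I_N * 'I_N) -> K}) j : 'M[K]_N :=
  \matrix_(s, t) f (j, (s, t)).

Definition mx_ffun (J : finType) (A : J -> 'M[K]_N) : {ffun J * ('I_N * 'I_N) -> K} :=
  [ffun x => A x.1 x.2.1 x.2.2].

Lemma mx_ffunK (J : finType) (A : J -> 'M[K]_N) j : ffun_mx (mx_ffun A) j = A j.
Proof. by apply/matrixP=> s t; rewrite mxE ffunE. Qed.

Lemma ffun_mxK (J : finType) (f : {ffun J * ('I_N * 'I_N) -> K}) :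
  mx_ffun (ffun_mx f) = f.
Proof. by apply/ffunP=> -[j [s t]]; rewrite ffunE mxE. Qed.

Lemma eq_mx_ffun (J : finType) (A B : J -> 'M[K]_N) : A =1 B -> mx_ffun A = mx_ffun B.
Proof. by move=> AB; apply/ffunP=> x; rewrite !ffunE AB. Qed.

Lemma mx_ffunD (J : finType) (A B : J -> 'M[K]_N) c :
  c *: mx_ffun A + mx_ffun B = mx_ffun (fun j => c%:A *: A j + B j).
Proof. by apply/ffunP=> x; rewrite !ffunE !mxE mulr_algl. Qed.

Lemma ffun_mx_linear (J : finType) c (f g : {ffun J * ('I_N * 'I_N) -> K}) j :
  ffun_mx (c *: f + g) j = c%:A *: ffun_mx f j + ffun_mx g j.
Proof. by apply/matrixP=> s t; rewrite !mxE !ffunE mulr_algl. Qed.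

Definition cobound (f : C0) : C1 :=
  mx_ffun (fun a => ffun_mx f (tgt a) *m Q a - Q a *m ffun_mx f (src a)).

Definition cocyc (f : C1) : C0 :=
  mx_ffun (fun i => moment Q (ffun_mx f) i + moment (ffun_mx f) Q i).

Fact cobound_linear : linear cobound.
Proof.
move=> c f g; rewrite /cobound mx_ffunD; apply: eq_mx_ffun => a.
rewrite !ffun_mx_linear mulmxDl mulmxDr -scalemxAl -scalemxAr scalerBr.
by rewrite opprD addrACA.
Qed.
HB.instance Definition _ := GRing.isLinear.Build k C0 C1 *:%R cobound cobound_linear.

Lemma tr_scalar a c (A : 'M[K]_N) :
  map_mx (tr a) (c%:A *: A) = c%:A *: map_mx (tr a) A.
Proof.
by apply/matrixP=> s t; rewrite !mxE sp_trZ // rpredZ ?rpred1.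
Qed.

Fact cocyc_linear : linear cocyc.
Proof.
move=> c f g; rewrite /cocyc mx_ffunD; apply: eq_mx_ffun => i.
rewrite scalerDr addrACA; congr (_ + _); rewrite scaler_sumr -big_split;
  apply: eq_bigr => a _ /=; rewrite scalerA mulrC -scalerA -scalerDr;
  congr (_ *: _); rewrite -tr_scalar -raddfD /=; congr (map_mx _ _);
  rewrite ffun_mx_linear.
  by rewrite mulmxDr -scalemxAr.
by rewrite mulmxDl -scalemxAl.
Qed.
HB.instance Definition _ := GRing.isLinear.Build k C1 C0 *:%R cocyc cocyc_linear.

Definition entry_space (J : finType) (E : J -> {subfield K}) (r c : J -> nat)
    (x : J * ('I_N * 'I_N)) : {vspace K} :=
  if (x.2.1 < r x.1)%N && (x.2.2 < c x.1)%N then E x.1 : {vspace K} else 0%VS.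

Lemma entry_spaceP (J : finType) E r c (f : {ffun J * ('I_N * 'I_N) -> K}) :
  reflect (forall j, padded (E j) (r j) (c j) (ffun_mx f j))
          (f \in ffun_space (entry_space E r c)).
Proof.
apply: (iffP (ffun_spaceP _ _)) => [fU j|gf [j [s t]]].
  have fU' s t := fU (j, (s, t)).
  apply: padded_entries => s t; have := fU' s t; rewrite /entry_space mxE /=.
  - by case: ifP => // _; rewrite memv0 => /eqP->; rewrite mem0v.
  - by move=> + ss; rewrite ss memv0 => /eqP.
  - by move=> + tt; rewrite tt andbF memv0 => /eqP.
have fE : f (j, (s, t)) = ffun_mx f j s t by rewrite mxE.
rewrite fE /entry_space /=; case: ifP => [_|/negbT]; first exact: padded_in (gf j).
rewrite negb_and memv0 => /orP[/negbTE h|/negbTE h].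
  by rewrite (padded_row0 _ (gf j) h).
by rewrite (padded_col0 _ (gf j) h).
Qed.

Lemma dim_entry_space (J : finType) (E : J -> {subfield K}) r c :
  (forall j, r j <= N)%N -> (forall j, c j <= N)%N ->
  \dim (ffun_space (entry_space E r c)) = (\sum_j r j * c j * \dim (E j))%N.
Proof.
move=> rN cN; rewrite dim_ffun_space.
rewrite (eq_bigr (fun x : J * ('I_N * 'I_N) =>
  (x.2.1 < r x.1)%N * ((x.2.2 < c x.1)%N * \dim (E x.1)))%N); last first.
  move=> [j [s t]] _ /=; rewrite /entry_space /=.
  by case: (s < _)%N; case: (t < _)%N; rewrite ?mul1n ?mul0n ?muln0 ?dimv0.
rewrite -(pair_bigA _ (fun j (x : 'I_N * 'I_N) =>
  (x.1 < r j)%N * ((x.2 < c j)%N * \dim (E j)))%N) /=.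
apply: eq_bigr => j _.
rewrite -(pair_bigA _ (fun s t : 'I_N =>
  (s < r j)%N * ((t < c j)%N * \dim (E j)))%N) /=.
have cnt q : (q <= N)%N -> (\sum_(s < N) (s < q)%N = q)%N.
  by move=> qN; rewrite -big_mkcond /= (big_ord_narrow qN) sum1_card card_ord.
under eq_bigr => s _ do rewrite -big_distrr -big_distrl /= cnt //.
by rewrite -big_distrl /= cnt // mulnA.
Qed.

Lemma padded_tr a r c (A : 'M[K]_N) : padded (ka a) r c A ->
  padded (kv (src a)) r c (map_mx (tr a) A).
Proof.
move=> gA; apply: padded_entries => [s t|s t h|s t h]; rewrite mxE.
- by rewrite sp_tr_in // (padded_in _ _ gA).
- by rewrite (padded_row0 _ gA h) raddf0.
- by rewrite (padded_col0 _ gA h) raddf0.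
Qed.

Lemma padded_moment (X Y : sp_arrow P -> 'M[K]_N) : arrow_fam m X -> arrow_fam m Y ->
  vertex_fam m (fun i => moment Y X i).
Proof.
move=> gX gY i; rewrite /moment.
elim/big_ind: _ => [|A B|a /eqP sa]; [exact: padded0 | exact: paddedD |].
have gA : padded (kv i) (m i) (m i) (map_mx (tr a) (Y (opp a) *m X a)).
  by rewrite -sa; apply: padded_tr; apply: paddedM (padded_opp a gY) (gX a).
by rewrite scaler_sign; case: (sg a); rewrite //; apply: paddedN.
Qed.

(** C1 has dimension at most dim (cocycles) + dim C0, rigidity bounds the first
    summand by the dimension of the coboundaries, and this is less than dim C0
    as the identity has coboundary zero. *)
Lemma rigid_dim : is_rigid m Q -> (exists i, m i != 0%N) ->
  (\sum_a m (tgt a) * m (src a) * \dim (ka a)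
     < 2 * \sum_i m i * m i * \dim (kv i))%N.
Proof.
move=> rQ [i0 m0].
pose W0 := ffun_space (entry_space kv m m).
pose W1 := ffun_space (entry_space ka (fun a => m (tgt a)) (fun a => m (src a))).
rewrite -(dim_entry_space kv mN mN).
rewrite -(@dim_entry_space _ ka (fun a => m (tgt a)) (fun a => m (src a))) //.
rewrite -/W0 -/W1 -(limg_ker_dim (linfun cocyc) W1) mul2n -addnn -addSn.
apply: leq_add; last first.
  apply: dimvS; apply/subvP=> _ /memv_imgP[f /entry_spaceP gf ->].
  rewrite lfunE; apply/entry_spaceP=> i; rewrite mx_ffunK.
  by apply: paddedD; apply: padded_moment.
apply: (@leq_ltn_trans (\dim (linfun cobound @: W0))).
  apply: dimvS; apply/subvP=> f; rewrite memv_cap memv_ker lfunE.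
  case/andP=> /entry_spaceP gf /eqP cf.
  have [|F [gF fF]] := rQ (ffun_mx f).
    split=> // i; have /(congr1 (fun g => ffun_mx g i)) := cf.
    rewrite mx_ffunK => ->; by apply/matrixP=> s t; rewrite !mxE ffunE.
  have -> : f = linfun cobound (mx_ffun F).
    rewrite lfunE /= -[LHS]ffun_mxK; apply: eq_mx_ffun => a.
    by rewrite fF !mx_ffunK.
  by apply: memv_img; apply/entry_spaceP=> i; rewrite mx_ffunK.
rewrite -(limg_ker_dim (linfun cobound) W0) -[X in (X < _)%N]add0n ltn_add2r.
rewrite lt0n dimv_eq0; apply/eqP => /vspaceP K0.
pose e := mx_ffun (fun i : 'I_n => pid_mx (m i) : 'M[K]_N).
have : e \in (W0 :&: lker (linfun cobound))%VS.
  rewrite memv_cap memv_ker lfunE; apply/andP; split.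
    by apply/entry_spaceP=> i; rewrite mx_ffunK; apply: padded_pid.
  apply/eqP/ffunP=> x; rewrite !ffunE !mx_ffunK.
  by rewrite (padded_l (gQ _)) (padded_r (gQ _)) subrr mxE.
rewrite K0 memv0 => /eqP/ffunP.
have lt0 : (0 < N)%N by apply: leq_trans (mN i0); rewrite lt0n.
move=> /(_ (i0, (Ordinal lt0, Ordinal lt0))); rewrite !ffunE !mxE /= lt0n m0.
by move/eqP; rewrite oner_eq0.
Qed.

End DimensionCount.

End SpeciesTheory.

(** * The species of a preprojective algebra *)
Section DualBasis.
Variables (k : fieldType) (L : fieldExtType k) (F E : {subfield L}).
Variables (t : {additive L -> L}) (X Y : seq L).
Hypothesis sFE : (F <= E)%VS.
Hypothesis tZ : forall c x, c \in F -> t (c * x) = c * t x.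
Hypothesis Xbasis : basis_of (vspaceOver F E) (X : seq (fieldOver F)).
Hypothesis sizeY : size Y = size X.
Hypothesis YE : {subset Y <= E}.
Hypothesis tXY : forall p q, (p < size X)%N -> (q < size X)%N ->
  t (X`_p * Y`_q) = (p == q)%:R.

Lemma mem_nthE (Z : seq L) p : {subset Z <= E} -> Z`_p \in E.
Proof.
move=> ZE; case: (ltnP p (size Z)) => h; first exact: ZE (mem_nth 0 h).
by rewrite nth_default // mem0v.
Qed.

Lemma basis_over_sub : {subset X <= E}.
Proof.
move=> x xX; rewrite -(mem_aspaceOver sFE).
by apply: (basis_mem (X := (X : seq (fieldOver F))) Xbasis).
Qed.

Lemma basis_over_coord (Z : seq L) x :
  basis_of (vspaceOver F E) (Z : seq (fieldOver F)) -> x \in E ->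
  exists2 c : 'I_(size Z) -> L, (forall p, c p \in F) &
    x = \sum_(p < size Z) c p * Z`_p.
Proof.
move=> Zb xE; have xE' : (x : fieldOver F) \in vspaceOver F E.
  by rewrite mem_aspaceOver.
pose Z' := in_tuple (Z : seq (fieldOver F)).
have -> : x = \sum_(p < size Z) vsval (coord Z' p (x : fieldOver F)) * Z`_p.
  exact: (@coord_basis _ _ (vspaceOver F E) _ Z' (x : fieldOver F)).
eexists; last by [].
by move=> p; apply: subvsP.
Qed.

Lemma dual_coord (c : nat -> L) q : (forall p, (p < size X)%N -> c p \in F) ->
  (q < size X)%N -> t (X`_q * \sum_(p < size X) c p * Y`_p) = c q.
Proof.
move=> cF lq; rewrite mulr_sumr raddf_sum (bigD1 (Ordinal lq)) //= big1.
  by rewrite addr0 mulrCA tZ ?cF // tXY // eqxx mulr1.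
move=> p /eqP pq; rewrite mulrCA tZ ?cF // tXY //.
by case: eqP => [e|]; rewrite ?mulr0 //; case: pq; apply: val_inj.
Qed.

(** The dual family is free, because the trace form reads off its coefficients,
    and it has as many elements as a basis. *)
Lemma dual_basis : basis_of (vspaceOver F E) (Y : seq (fieldOver F)).
Proof.
rewrite basisEfree; apply/and3P; split.
- change (is_true (free (in_tuple (Y : seq (fieldOver F))))).
  apply/freeP => c c0 q.
  have lq : (q < size X)%N by rewrite -sizeY.
  pose c' p := if insub p is Some p' then vsval (c p') else 0.
  have c'E (p : 'I_(size Y)) : c' p = vsval (c p) by rewrite /c' valK.
  have c'F p : (p < size X)%N -> c' p \in F.
    by move=> _; rewrite /c'; case: insub => [p'|]; rewrite ?subvsP ?mem0v.
  apply: val_inj; change (vsval (c q) = 0); rewrite -c'E -(dual_coord c'F lq).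
  have -> : \sum_(p < size X) c' p * Y`_p = 0.
    by rewrite -[RHS]c0 -sizeY; apply: eq_bigr => p _; rewrite c'E.
  by rewrite mulr0 raddf0.
- apply/span_subvP=> y yY; rewrite mem_aspaceOver //; exact: YE.
- by rewrite sizeY -(size_basis (X := in_tuple (X : seq (fieldOver F))) Xbasis).
Qed.

Lemma dual_expand x : x \in E -> x = \sum_(p < size X) t (X`_p * x) * Y`_p.
Proof.
move=> xE; have [c cF xc] := basis_over_coord dual_basis xE.
pose c' p := if insub p is Some p' then c p' else 0.
have xc' : x = \sum_(p < size X) c' p * Y`_p.
  by rewrite -sizeY [LHS]xc; apply: eq_bigr => p _; rewrite /c' valK.
rewrite {1}xc'; apply: eq_bigr => p _; congr (_ * _); rewrite xc' dual_coord //.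
by move=> q _; rewrite /c'; case: insub => [q'|]; rewrite ?cF ?mem0v.
Qed.

(** Expand x in the basis and 1 in the dual basis: the trace becomes a sum of
    products of coefficients. *)
Lemma dual_trace_in x : x \in E -> t x \in F.
Proof.
move=> xE; have [c cF ->] := basis_over_coord Xbasis xE.
have [d dF d1] := basis_over_coord dual_basis (mem1v E).
rewrite raddf_sum rpred_sum // => p _; rewrite tZ ?cF // rpredM ?cF //.
rewrite -[X`_p]mulr1 d1 mulr_sumr raddf_sum rpred_sum // => q _.
rewrite mulrCA tZ ?dF // rpredM ?dF // tXY ?rpred_nat //.
by rewrite -sizeY.
Qed.

Lemma dim_over_basis : \dim E = (size X * \dim F)%N.
Proof.
pose X' := in_tuple (X : seq (fieldOver F)).
rewrite -[size X](size_basis (X := X') Xbasis) dim_aspaceOver // divnK //.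
exact: field_dimS.
Qed.

End DualBasis.

Section PreprojSpecies.
Variables (n : nat) (C : cartanDatum n) (k : fieldType).
Variables (K : splittingFieldType k) (P : preprojDatum C K).
Local Notation kap := (pd_kap P).

(** The inclusion of Galois groups is the reverse divisibility of their orders,
    as these groups lie in a cyclic group. *)
Lemma kap_sub m1 m2 : (m1 %| m2)%N -> (m2 %| lcm_all C)%N ->
  (kap m1 <= kap m2)%VS.
Proof.
move=> d12 d2; have d1 := dvdn_trans d12 d2.
have gal (E : {subfield K}) : galois E {:K}.
  by apply: galoisS (pd_galois P); rewrite sub1v subvf.
have L0 : (0 < lcm_all C)%N by rewrite -(pd_order P) cardG_gt0.
have dimK : \dim {:K} = lcm_all C.
  by rewrite -(pd_order P) -(galois_dim (pd_galois P)) dimv1 divn1.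
have sG (E : {subfield K}) : 'Gal({:K} / E)%g \subset 'Gal({:K} / 1)%g.
  by apply: galS; apply: sub1v.
have cardG m : (m %| lcm_all C)%N -> #|'Gal({:K} / kap m)%g| = (lcm_all C %/ m)%N.
  by move=> dm; rewrite -(galois_dim (gal _)) dimK (pd_dim_kap P dm).
rewrite -(galois_fixedField (gal (kap m1))) -(galois_fixedField (gal (kap m2))).
apply: fixedFieldS; rewrite -(cardSg_cyclic (pd_cyclic P) (sG _) (sG _)).
rewrite !cardG //; case/dvdnP: d12 d2 => q -> /dvdnP[r Lr].
have := L0; rewrite Lr !muln_gt0 => /and3P[r0 q0 m0].
by rewrite mulnK ?muln_gt0 ?q0 // mulnA mulnK // dvdn_mulr.
Qed.

Lemma d_dvd_lcm_all i : (cd_d C i %| lcm_all C)%N.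
Proof. by rewrite /lcm_all (bigD1 i) //= dvdn_lcml. Qed.

Lemma lcmd_dvd i j : (lcmd C i j %| lcm_all C)%N.
Proof. by rewrite dvdn_lcm !d_dvd_lcm_all. Qed.

Lemma lcmdC i j : lcmd C i j = lcmd C j i. Proof. exact: lcmnC. Qed.

Lemma kap_src i j : (kap (cd_d C i) <= kap (lcmd C i j))%VS.
Proof. by apply: kap_sub (dvdn_lcml _ _) (lcmd_dvd _ _). Qed.

Lemma narrows_neq i j : 'I_(narrows C i j) -> i != j.
Proof. by rewrite /narrows; case: eqP => // _ []. Qed.

Definition pp_arrow : finType := {i : 'I_n & {j : 'I_n & 'I_(narrows C i j)}}.
Definition pp_src (a : pp_arrow) : 'I_n := tag a.
Definition pp_tgt (a : pp_arrow) : 'I_n := tag (tagged a).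
Definition mk_arrow i j (a : 'I_(narrows C i j)) : pp_arrow :=
  Tagged _ (Tagged (fun j => 'I_(narrows C i j)) a).
Definition pp_opp (a : pp_arrow) : pp_arrow := mk_arrow (pd_star P (tagged (tagged a))).

Lemma pp_oppK : involutive pp_opp.
Proof. by case=> i [j a]; rewrite /pp_opp /= pd_starK. Qed.

Lemma pp_neq a : pp_tgt a != pp_src a.
Proof. by case: a => i [j a] /=; rewrite eq_sym narrows_neq. Qed.

Definition pp_kv i : {subfield K} := kap (cd_d C i).
Definition pp_ka a : {subfield K} := kap (lcmd C (pp_src a) (pp_tgt a)).
Definition pp_tr a : {additive K -> K} := galTrace (pp_kv (pp_src a)) (pp_ka a).
(** For an arrow a : i -> j the datum [pd_basis P i j] is a basis of kappa(d_ij)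
    over kappa(d_i), the field of the source of a. *)
Definition pp_eb a := pd_basis P (pp_src a) (pp_tgt a).
Definition pp_ed a := pd_dual P (pp_src a) (pp_tgt a).

Lemma pp_kv_sub a : (pp_kv (pp_src a) <= pp_ka a)%VS.
Proof. exact: kap_src. Qed.

Lemma pp_trZ a c x : c \in pp_kv (pp_src a) -> pp_tr a (c * x) = c * pp_tr a x.
Proof.
move=> cE; rewrite /pp_tr /= /galTrace mulr_sumr; apply: eq_bigr => f fG.
by rewrite rmorphM /= (fixed_gal (pp_kv_sub a) fG cE).
Qed.

Lemma pp_basis a : basis_of (vspaceOver (pp_kv (pp_src a)) (pp_ka a))
  (pp_eb a : seq (fieldOver (pp_kv (pp_src a)))).
Proof. by rewrite /pp_ka lcmdC; apply: pd_basisP (pp_neq a). Qed.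

Lemma pp_size a : size (pp_ed a) = size (pp_eb a).
Proof. exact: pd_dual_size (pp_neq a). Qed.

Lemma pp_ed_sub a : {subset pp_ed a <= pp_ka a}.
Proof. by rewrite /pp_ka lcmdC; apply: pd_dual_in (pp_neq a). Qed.

Lemma pp_dual a p q : (p < size (pp_eb a))%N -> (q < size (pp_eb a))%N ->
  pp_tr a ((pp_eb a)`_p * (pp_ed a)`_q) = (p == q)%:R.
Proof.
move=> lp lq; rewrite /pp_tr /pp_ka lcmdC.
exact: (pd_dualP (pp_neq a) lp lq).
Qed.

Definition pp_species : species K n := {|
  sp_arrow := pp_arrow;
  sp_src := pp_src;
  sp_opp := pp_opp;
  sp_oppK := pp_oppK;
  sp_noloop := pp_neq;
  sp_kv := pp_kv;
  sp_ka := pp_ka;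
  sp_ka_opp := fun a => congr1 kap (lcmdC _ _);
  sp_kv_sub := pp_kv_sub;
  sp_sg := fun a => pd_sgn P (pp_src a) (pp_tgt a) == -1;
  sp_tr := pp_tr;
  sp_trZ := pp_trZ;
  sp_tr_in := fun a => dual_trace_in (pp_kv_sub a) (@pp_trZ a) (pp_basis a)
     (pp_size a) (@pp_ed_sub a) (@pp_dual a);
  sp_rk := fun a => size (pp_eb a);
  sp_eb := fun a p => (pp_eb a)`_p;
  sp_ed := fun a p => (pp_ed a)`_p;
  sp_eb_in := fun a p => mem_nthE p (basis_over_sub (pp_kv_sub a) (pp_basis a));
  sp_ed_in := fun a p => mem_nthE p (@pp_ed_sub a);
  sp_dual := @pp_dual;
  sp_expand := fun a => dual_expand (pp_kv_sub a) (@pp_trZ a) (pp_basis a)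
     (pp_size a) (@pp_ed_sub a) (@pp_dual a);
  sp_dim := fun a => dim_over_basis (pp_kv_sub a) (pp_basis a)
|}.

End PreprojSpecies.

(** * Modules as matrix representations *)
Section Coordinates.
Variables (k : fieldType) (K : fieldExtType k) (F : {subfield K}) (N : nat).
Variable V : vectType (subvs_of F).
Local Notation d := (\dim {:V}).

(** Coordinates in a basis of V over F, viewed in K and padded to N rows. *)
Definition coords (v : V) : 'cV[K]_N :=
  \col_s (if insub (val s) is Some s' then vsval (coord (vbasis {:V}) (s' : 'I_d) v) else 0).

Fact coords_is_zmod_morphism : zmod_morphism coords.
Proof.
move=> x y; apply/colP=> s; rewrite !mxE; case: insubP => [s' _ _|_].
  by rewrite !raddfB.
by rewrite subr0.
Qed.
HB.instance Definition _ :=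
  GRing.isZmodMorphism.Build V 'cV[K]_N coords coords_is_zmod_morphism.

Lemma coordsZ c v : coords (c *: v) = vsval c *: coords v.
Proof.
apply/colP=> s; rewrite !mxE; case: insubP => [s' _ _|_].
  by rewrite linearZ.
by rewrite mulr0.
Qed.

Lemma coords_over v : coords v \is a mxOver F.
Proof.
by apply/mxOverP=> s t; rewrite mxE; case: insubP => [s' _ _|_]; rewrite ?subvsP ?mem0v.
Qed.

Lemma coords_pid v : pid_mx d *m coords v = coords v.
Proof.
apply/colP=> s; rewrite mul_pid_mxE mxE; case: insubP => [s' /= -> //|/negPf /= ->].
by [].
Qed.

Hypothesis dN : (d <= N)%N.

Definition of_coords (u : 'cV[K]_N) : V :=
  \sum_(s < d) vsproj F (u (widen_ord dN s) 0) *: (vbasis {:V})`_s.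

Lemma coordsK : cancel coords of_coords.
Proof.
move=> v; rewrite /of_coords [RHS](coord_vbasis (memvf v)); apply: eq_bigr => s _.
by rewrite mxE /= valK vsvalK.
Qed.

Lemma of_coordsK u : u \is a mxOver F -> pid_mx d *m u = u -> coords (of_coords u) = u.
Proof.
move=> /mxOverP uE eu; apply/colP=> s; rewrite mxE; case: insubP => [s' sd es|/negPf sd].
  rewrite /of_coords coord_sum_free; last exact: basis_free (vbasisP _).
  by rewrite vsprojK //; congr (u _ 0); apply: val_inj.
by rewrite -eu mul_pid_mxE sd.
Qed.

Lemma coords_inj : injective coords. Proof. exact: can_inj coordsK. Qed.

Lemma of_coords_delta (t : 'I_N) :
  coords (of_coords (delta_mx t 0)) = if (t < d)%N then delta_mx t 0 else 0.
Proof.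
case: ifP => td.
  rewrite of_coordsK //; first by apply/mxOverP=> x y; rewrite mxE rpred_nat.
  apply/matrixP=> x y; rewrite mul_pid_mxE mxE; case: ifP => // xd.
  by case: eqP => // xt; rewrite -xt xd in td.
rewrite /of_coords big1 ?raddf0 // => x _.
rewrite mxE (_ : _ == t = false) ?raddf0 ?scale0r //.
by apply/eqP=> /(congr1 val) /= xt; move: td; rewrite -xt ltn_ord.
Qed.

Lemma coords_expand v : v = \sum_(t < N) vsproj F (coords v t 0) *: of_coords (delta_mx t 0).
Proof.
apply: coords_inj; apply/colP=> s.
rewrite raddf_sum summxE (bigD1 s) //= coordsZ of_coords_delta.
rewrite [X in _ = X + _]mxE vsprojK ?(mxOverP (coords_over _)) // big1 ?addr0 => [|t ts].
  case: ifP => sd; first by rewrite [delta_mx _ _ _ _]mxE !eqxx mulr1.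
  by rewrite -coords_pid mul_pid_mxE sd mul0r.
rewrite coordsZ of_coords_delta [LHS]mxE.
case: ifP => _; last by rewrite [X in _ * X]mxE mulr0.
by rewrite [delta_mx _ _ _ _]mxE eq_sym (negPf ts) mulr0.
Qed.

Lemma mulmx_coords_eq0 p (A : 'M[K]_(p, N)) : A *m pid_mx d = A ->
  (forall v, A *m coords v = 0) -> A = 0.
Proof.
move=> Ad A0; apply/matrixP=> s t; rewrite -Ad mul_mx_pidE mxE; case: ifP => // td.
have := A0 (of_coords (delta_mx t 0)); rewrite of_coords_delta td.
by move/matrixP/(_ s 0); rewrite -colE !mxE.
Qed.

End Coordinates.
Arguments of_coords {k K F N V} dN u.
Arguments coords {k K F} N {V} v.

Section ModuleMatrices.
Variables (n : nat) (C : cartanDatum n) (k : fieldType).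
Variables (K : splittingFieldType k) (P : preprojDatum C K) (B : fdLamModule P).
Local Notation S := (pp_species P).

Definition vdim i : nat := \dim {: fd_car B i}.
Definition total_dim : nat := \sum_i vdim i.
Local Notation N := total_dim.
Local Notation m := vdim.

Lemma vdim_le i : (m i <= N)%N.
Proof. by rewrite /total_dim (bigD1 i) //= leq_addr. Qed.

Definition arrow_maps := forall i j, arrow_bimod P i j -> fd_car B i -> fd_car B j.

(** Biadditive, balanced and left linear maps E(j <- i) x M_i -> M_j: module
    structures without the preprojective relations, and also the cocycles
    of extensions. *)
Record is_bimodule_map (f : arrow_maps) : Prop := IsBimoduleMap {
  bmDl : forall i j (e e' : arrow_bimod P i j) x, f i j (e + e') x = f i j e x + f i j e' x;
  bmDr : forall i j (e : arrow_bimod P i j) x y, f i j e (x + y) = f i j e x + f i j e y;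
  bm_bal : forall i j (e : arrow_bimod P i j) c x, f i j (bimodr e c) x = f i j e (c *: x);
  bm_lin : forall i j c (e : arrow_bimod P i j) x, f i j (bimodl c e) x = c *: f i j e x
}.

Local Notation coB := (@coords _ _ _ N _).

(** The entry at (s, t) represents through the trace form the linear functional
    sending x to coordinate s of the image of the basis vector t under x a; it is
    expanded in the dual basis. *)
Definition maps_mx (f : arrow_maps) (a : sp_arrow S) : 'M[K]_N :=
  \matrix_(s, t) \sum_(p < sp_rk (sp_opp a))
    coB (f _ _ (arrow_coef P (sp_eb (sp_opp a) p) (tagged (tagged a)))
             (of_coords (vdim_le _) (delta_mx t 0))) s 0 * sp_ed (sp_opp a) p.

Section OneMap.
Variables (f : arrow_maps) (bf : is_bimodule_map f).

Lemma bm0r i j (e : arrow_bimod P i j) : f e 0 = 0.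
Proof. by apply: (addIr (f e 0)); rewrite -bmDr // !add0r. Qed.

Lemma bm0l i j x : f (0 : arrow_bimod P i j) x = 0.
Proof. by apply: (addIr (f 0 x)); rewrite -bmDl // !add0r. Qed.

Lemma bm_sumr i j (e : arrow_bimod P i j) (J : Type) (r : seq J) (p : pred J) g :
  f e (\sum_(x <- r | p x) g x) = \sum_(x <- r | p x) f e (g x).
Proof. by apply: (big_morph (f e)) => [x y|]; rewrite ?bmDr ?bm0r. Qed.

Lemma bm_suml i j x (J : Type) (r : seq J) (p : pred J) (g : J -> arrow_bimod P i j) :
  f (\sum_(y <- r | p y) g y) x = \sum_(y <- r | p y) f (g y) x.
Proof. by apply: (big_morph (fun e => f e x)) => [e e'|]; rewrite ?bmDl ?bm0l. Qed.

Lemma bmNr i j (e : arrow_bimod P i j) x : f e (- x) = - f e x.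
Proof. by apply: (addIr (f e x)); rewrite -bmDr // !addNr bm0r. Qed.

End OneMap.

Lemma arrow_bimodE i j (e : arrow_bimod P i j) :
  e = \sum_a arrow_coef P (vsval (e a)) a.
Proof.
apply/ffunP=> b; rewrite sum_ffunE (bigD1 b) //= ffunE eqxx big1 ?addr0 ?vsvalK //.
by move=> a ab; rewrite ffunE eq_sym (negPf ab).
Qed.

Lemma arrow_coefD i j (a : 'I_(narrows C i j)) x y :
  arrow_coef P (x + y) a = arrow_coef P x a + arrow_coef P y a.
Proof.
by apply/ffunP=> b; rewrite !ffunE; case: ifP; rewrite ?addr0 // raddfD.
Qed.

Lemma arrow_coef_sum i j (a : 'I_(narrows C i j)) (J : Type) (r : seq J) (p : pred J) g :
  arrow_coef P (\sum_(x <- r | p x) g x) a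
    = \sum_(x <- r | p x) arrow_coef P (g x) a.
Proof.
apply: (big_morph (fun y => arrow_coef P y a)); first by move=> *; apply: arrow_coefD.
by apply/ffunP=> b; rewrite !ffunE raddf0; case: ifP.
Qed.

Lemma arrow_coefl i j (a : 'I_(narrows C i j)) (c : subvs_of (pd_kap P (cd_d C j))) x :
  x \in pd_kap P (lcmd C i j) ->
  bimodl c (arrow_coef P x a) = arrow_coef P (vsval c * x) a.
Proof.
move=> xE; apply/ffunP=> b; rewrite !ffunE; case: ifP => _; last by rewrite mulr0 raddf0.
by rewrite vsprojK.
Qed.

Lemma arrow_coefr i j (a : 'I_(narrows C i j)) (c : subvs_of (pd_kap P (cd_d C i))) x :
  x \in pd_kap P (lcmd C i j) ->
  bimodr (arrow_coef P x a) c = arrow_coef P (x * vsval c) a.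
Proof.
move=> xE; apply/ffunP=> b; rewrite !ffunE; case: ifP => _; last by rewrite mul0r raddf0.
by rewrite vsprojK.
Qed.

Lemma maps_mx_padded f : is_bimodule_map f -> arrow_fam m (maps_mx f).
Proof.
move=> bf a; apply: padded_entries => [s t|s t h|s t h]; rewrite mxE.
- rewrite rpred_sum // => p _; rewrite rpredM //; last first.
    by rewrite -(sp_ka_opp a) sp_ed_in.
  by apply: (subvP (sp_kv_tgt a)); apply: (mxOverP (coords_over _ _)).
- rewrite big1 // => p _; rewrite -coords_pid mul_pid_mxE.
  by rewrite (_ : (s < _)%N = false) ?mul0r.
- rewrite big1 // => p _; rewrite (_ : of_coords _ _ = 0) ?bm0r ?raddf0 ?mxE ?mul0r //.
  by apply: (coords_inj (vdim_le _)); rewrite of_coords_delta h raddf0.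
Qed.

(** The trace form of the arrow field over the field of the target is perfect, so
    left linearity in x gives the formula on basis vectors; balancedness
    extends it to all vectors. *)
Lemma maps_mxE f i j (a : 'I_(narrows C i j)) x v : is_bimodule_map f ->
  x \in pd_kap P (lcmd C i j) ->
  coB (f i j (arrow_coef P x a) v) =
  map_mx (sp_tr (sp_opp (mk_arrow a : sp_arrow S)))
    (x *: (maps_mx f (mk_arrow a) *m coB v)).
Proof.
move=> bf; set b := sp_opp _.
change (pd_kap P (lcmd C i j)) with (sp_ka (mk_arrow a : sp_arrow S)).
move=> xE.
have xbE : x \in sp_ka b by rewrite sp_ka_opp.
have lin y w s : y \in sp_ka b -> coB (f i j (arrow_coef P y a) w) s 0 =
   \sum_(p < sp_rk b) sp_tr b (y * sp_ed b p) *
       coB (f i j (arrow_coef P (sp_eb b p) a) w) s 0.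
  move=> yE; rewrite {1}(sp_expand_r yE) arrow_coef_sum bm_suml // raddf_sum summxE /=.
  apply: eq_bigr => p _.
  have cE : sp_tr b (y * sp_ed b p) \in pd_kap P (cd_d C j).
    by apply: (@sp_tr_in _ _ _ S b); rewrite rpredM ?sp_ed_in.
  rewrite -[in LHS](vsprojK cE) -arrow_coefl; last first.
    have := sp_eb_in b p; rewrite sp_ka_opp; exact.
  by rewrite bm_lin // coordsZ mxE vsprojK.
have key y t s : y \in sp_ka b ->
    coB (f i j (arrow_coef P y a) (of_coords (vdim_le _) (delta_mx t 0))) s 0
    = sp_tr b (y * maps_mx f (mk_arrow a) s t).
  move=> yE; rewrite lin // mxE mulr_sumr raddf_sum; apply: eq_bigr => p _.
  rewrite [in RHS]mulrCA [RHS]sp_trZ; first by rewrite mulrC.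
  exact: (mxOverP (coords_over _ _)).
rewrite [in LHS](coords_expand (vdim_le i) v) bm_sumr //.
apply/colP=> s; rewrite raddf_sum summxE !mxE mulr_sumr raddf_sum.
apply: eq_bigr => t _ /=; set c := vsproj _ _.
have cE : vsval c = coB v t 0 by rewrite vsprojK // (mxOverP (coords_over _ _)).
rewrite -bm_bal // arrow_coefr // cE.
have uE : coB v t 0 \in sp_ka b.
  rewrite sp_ka_opp; apply: (subvP (sp_kv_sub (mk_arrow a : sp_arrow S))).
  exact: (mxOverP (coords_over _ _)).
rewrite key ?rpredM //; congr (galTrace _ _ _).
by rewrite -mulrA [coB v t 0 * _]mulrC.
Qed.

End ModuleMatrices.

Section TraceColumns.
Variables (k : fieldType) (K : fieldExtType k) (n : nat) (P : species K n).
Variable N : nat.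
Implicit Type a : sp_arrow P.

Lemma map_tr_mulr a (A : 'M[K]_N) (u : 'cV[K]_N) :
  u \is a mxOver (sp_kv P (sp_src a)) ->
  map_mx (sp_tr a) (A *m u) = map_mx (sp_tr a) A *m u.
Proof.
move=> /mxOverP uE; apply/colP=> s; rewrite !mxE raddf_sum.
by apply: eq_bigr => t _; rewrite mxE sp_trZr.
Qed.

Lemma map_tr_mull a (A : 'M[K]_N) (u : 'cV[K]_N) :
  A \is a mxOver (sp_kv P (sp_src a)) ->
  map_mx (sp_tr a) (A *m u) = A *m map_mx (sp_tr a) u.
Proof.
move=> /mxOverP uE; apply/colP=> s; rewrite !mxE raddf_sum.
by apply: eq_bigr => t _; rewrite mxE sp_trZ.
Qed.

(** The sum over the dual bases in the relation contracts: the trace of the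
    inner map disappears. *)
Lemma tr_compose a (Y : 'M[K]_N) (w : 'cV[K]_N) : w \is a mxOver (sp_ka a) ->
  \sum_(p < sp_rk (sp_opp a)) map_mx (sp_tr a)
    (sp_ed (sp_opp a) p *: (Y *m map_mx (sp_tr (sp_opp a)) (sp_eb (sp_opp a) p *: w)))
  = map_mx (sp_tr a) (Y *m w).
Proof.
move=> /mxOverP wE; rewrite -raddf_sum; congr (map_mx _ _); apply/colP=> s.
rewrite summxE mxE; under eq_bigr => p _ do rewrite !mxE mulr_sumr.
rewrite exchange_big; apply: eq_bigr => t _ /=.
have wtE : w t 0 \in sp_ka (sp_opp a) by rewrite sp_ka_opp.
rewrite [in RHS](sp_expand wtE) mulr_sumr; apply: eq_bigr => p _.
by rewrite !mxE mulrCA [_ * sp_tr _ _]mulrC.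
Qed.

Lemma tr_eq0_mx a (A : 'M[K]_N) (u : 'cV[K]_N) :
  A \is a mxOver (sp_ka a) -> u \is a mxOver (sp_ka a) ->
  (forall x, x \in sp_ka a -> map_mx (sp_tr (sp_opp a)) (x *: (A *m u)) = 0) ->
  A *m u = 0.
Proof.
move=> AE uE A0; apply/colP=> s; rewrite [RHS]mxE; apply: (@sp_tr_nondeg _ _ _ P (sp_opp a)).
  by rewrite sp_ka_opp (mxOverP (mxOverM AE uE)).
by move=> y; rewrite sp_ka_opp => /A0/colP/(_ s); rewrite 3!mxE [RHS]mxE.
Qed.

End TraceColumns.

Section RelationMatrices.
Variables (n : nat) (C : cartanDatum n) (k : fieldType).
Variables (K : splittingFieldType k) (P : preprojDatum C K) (B : fdLamModule P).
Local Notation S := (pp_species P).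
Local Notation N := (total_dim B).
Local Notation m := (vdim B).
Local Notation coB := (@coords _ _ _ N _).
Local Notation arrow_maps := (arrow_maps B).
Implicit Types (f g : arrow_maps).

Lemma coords_kv i (v : fd_car B i) : coB v \is a mxOver (sp_kv S i).
Proof. exact: coords_over. Qed.

Lemma maps_mx_eq f (a : sp_arrow S) (A : 'M[K]_N) : is_bimodule_map f ->
  padded (sp_ka a) (m (sp_src (sp_opp a))) (m (sp_src a)) A ->
  (forall x v, x \in sp_ka a ->
     coB (f _ _ (arrow_coef P x (tagged (tagged a))) v)
       = map_mx (sp_tr (sp_opp a)) (x *: (A *m coB v))) ->
  maps_mx f a = A.
Proof.
move=> bf gA fA; apply/eqP; rewrite -subr_eq0; apply/eqP.
have gf := maps_mx_padded bf a.
have gD := paddedD gf (paddedN gA).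
apply: (mulmx_coords_eq0 (vdim_le B (pp_src a))); first exact: padded_r gD.
move=> v; apply: (@tr_eq0_mx _ _ _ S); first exact: padded_over gD.
  by apply: mxOverS (coords_kv v); apply/subvP; apply: (sp_kv_sub a).
move=> x xE; have := fA x v xE; move: xE; case: a {gA fA gf gD} v => i [j a] /= v.
move=> xE; rewrite maps_mxE // => h.
by rewrite mulmxBl scalerBr raddfB /= h subrr.
Qed.

(** The inverse construction, from matrices to bimodule maps. *)
Definition mx_maps (X : sp_arrow S -> 'M[K]_N) : arrow_maps := fun i j e v =>
  of_coords (vdim_le B j) (\sum_a map_mx (sp_tr (sp_opp (mk_arrow a : sp_arrow S)))
                       (vsval (e a) *: (X (mk_arrow a) *m coB v))).

Section MatricesToMaps.
Variable X : sp_arrow S -> 'M[K]_N.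
Hypothesis gX : arrow_fam m X.

Lemma coords_mx_maps i j (e : arrow_bimod P i j) v :
  coB (mx_maps X e v) = \sum_a map_mx (sp_tr (sp_opp (mk_arrow a : sp_arrow S)))
                       (vsval (e a) *: (X (mk_arrow a) *m coB v)).
Proof.
rewrite of_coordsK //.
  rewrite rpred_sum // => a _; apply/mxOverP=> s t; rewrite mxE.
  have trE w : w \in sp_ka (sp_opp (mk_arrow a : sp_arrow S)) ->
      sp_tr (sp_opp (mk_arrow a : sp_arrow S)) w \in pd_kap P (cd_d C j).
    by move=> wE; have h := sp_tr_in wE; exact h.
  apply: trE; rewrite mxE rpredM //; first by rewrite sp_ka_opp; apply: subvsP.
  rewrite sp_ka_opp; apply: mxOverP; apply: mxOverM (padded_over (gX _)) _.
  by apply: mxOverS (coords_kv v); apply/subvP; apply: (sp_kv_sub (mk_arrow a : sp_arrow S)).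
rewrite mulmx_sumr; apply: eq_bigr => a _.
apply/colP=> s; rewrite mul_pid_mxE; case: ifP => // sm.
have Xu0 : (X (mk_arrow a) *m coB v) s 0 = 0.
  by rewrite -(padded_l (gX _)) -mulmxA mul_pid_mxE [(s < _)%N]sm.
by rewrite 2!mxE Xu0 mulr0 raddf0.
Qed.

Lemma mx_maps_bimod : is_bimodule_map (mx_maps X).
Proof.
split=> [i j e e' x|i j e x y|i j e c x|i j c e x]; apply: (coords_inj (vdim_le B _));
  rewrite ?raddfD ?coordsZ /= !coords_mx_maps -?big_split ?scaler_sumr /=;
  apply: eq_bigr => a _; rewrite -?raddfD /=.
- by rewrite ffunE raddfD /= scalerDl.
- by rewrite raddfD /= mulmxDr scalerDr.
- rewrite ffunE coordsZ -scalemxAr scalerA vsprojK // rpredM ?subvsP //.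
  by apply: (subvP (sp_kv_sub (mk_arrow a : sp_arrow S))); apply: subvsP.
- rewrite ffunE vsprojK; last first.
    rewrite rpredM ?subvsP //.
    by apply: (subvP (sp_kv_tgt (mk_arrow a : sp_arrow S))); apply: subvsP.
  apply/colP=> s; rewrite !mxE -mulrA; apply: (@sp_trZ _ _ _ S).
  exact: subvsP.
Qed.

Lemma mx_mapsK a : maps_mx (mx_maps X) a = X a.
Proof.
apply: maps_mx_eq => //; first exact: mx_maps_bimod.
case: a => i [j a] x v xE /=; rewrite coords_mx_maps (bigD1 a) //= big1 ?addr0.
  by rewrite ffunE eqxx vsprojK.
by move=> b ba; rewrite ffunE (negPf ba) scale0r raddf0.
Qed.

End MatricesToMaps.

Lemma sum_arrows_at (V : nmodType) (G : sp_arrow S -> V) i :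
  \sum_(a : sp_arrow S | sp_src a == i) G a
    = \sum_(j | j != i) \sum_(a < narrows C i j) G (mk_arrow a).
Proof.
have -> : \sum_(a : sp_arrow S | sp_src a == i) G a =
   \sum_(i' | i' == i) \sum_(b : {j : 'I_n & 'I_(narrows C i' j)}) G (Tagged _ b).
  rewrite sig_big_dep /=; apply: eq_big => [[i' b]|[i' b] _] //=.
  by rewrite andbT.
rewrite big_pred1_eq.
have -> : \sum_(b : {j : 'I_n & 'I_(narrows C i j)}) G (Tagged _ b) =
   \sum_j \sum_(a < narrows C i j) G (mk_arrow a).
  by rewrite sig_big_dep /=; apply: eq_big => -[j a].
rewrite [RHS]big_mkcond; apply: eq_bigr => j _; case: eqP => //= ->.
rewrite big1 // => a _; exfalso; case: a; rewrite /narrows eqxx; by case.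
Qed.

(** The expression of the preprojective relation, with different bimodule maps for
    the two steps; it is bilinear in (g, f), and its polarization is the cocycle
    condition. *)
Definition rel_comp g f i (x : fd_car B i) : fd_car B i :=
  \sum_(j | j != i)
    (\sum_(a < narrows C i j) \sum_(p < size (pd_basis P j i))
      g _ _ (arrow_coef P (pd_dual P j i)`_p (pd_star P a))
        (f _ _ (arrow_coef P (pd_basis P j i)`_p a) x)) *~ pd_sgn P i j.

Lemma rel_compE g f i (x : fd_car B i) : is_bimodule_map g -> is_bimodule_map f ->
  coB (rel_comp g f x) = moment (maps_mx g) (maps_mx f) i *m coB x.
Proof.
move=> bg bf; rewrite /moment mulmx_suml sum_arrows_at raddf_sum.
apply: eq_bigr => j ji; rewrite raddfMz raddf_sum /=.
have sgnE (M : 'cV[K]_N) :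
    M *~ pd_sgn P i j = (-1) ^+ (pd_sgn P i j == -1) *: M.
  rewrite scaler_sign; case: (@pd_sgn_pm1 _ _ _ _ P i j); rewrite 1?eq_sym // => ->.
    by rewrite mulr1z.
  by rewrite eqxx mulrN1z.
rewrite sgnE scaler_sumr; apply: eq_bigr => a _.
rewrite -scalemxAl; congr (_ *: _).
pose b : sp_arrow S := mk_arrow a.
have uE : coB x \is a mxOver (sp_kv S (sp_src b)) by apply: coords_kv.
rewrite -[RHS](map_tr_mulr (a := b) _ uE) -mulmxA -(tr_compose (a := b)); last first.
  apply: mxOverM; first exact: padded_over (maps_mx_padded bf b).
  by apply: mxOverS uE; apply/subvP; apply: (sp_kv_sub b).
rewrite raddf_sum; apply: eq_bigr => p _ /=.
have bE : (pd_basis P j i)`_p \in pd_kap P (lcmd C i j).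
  by have := sp_eb_in (sp_opp b) p; rewrite sp_ka_opp.
have dE : (pd_dual P j i)`_p \in pd_kap P (lcmd C j i).
  by have := sp_ed_in (sp_opp b) p.
by rewrite maps_mxE // maps_mxE //=.
Qed.

End RelationMatrices.

Definition linear_fun (R : nzRingType) (V W : lmodType R) (f : V -> W) (lf : linear f) :
  {linear V -> W} := HB.pack f (GRing.isLinear.Build R V W *:%R f lf).

Section HomMatrices.
Variables (n : nat) (C : cartanDatum n) (k : fieldType).
Variables (K : splittingFieldType k) (P : preprojDatum C K) (B : fdLamModule P).
Local Notation S := (pp_species P).
Local Notation N := (total_dim B).
Local Notation m := (vdim B).
Local Notation coB := (@coords _ _ _ N _).
Local Notation arrow_maps := (arrow_maps B).
Local Notation vertex_fam := (vertex_fam S).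
Implicit Types (f g : arrow_maps).

Definition module_maps : arrow_maps := fun i j e x => lact (fd_str B) e x.
Definition module_mx := maps_mx module_maps.

Lemma module_maps_bimod : is_bimodule_map module_maps.
Proof.
by split=> *; rewrite /module_maps ?lactDl ?lactDr ?lact_bal ?lact_lin.
Qed.

Lemma moment_eq0 f g i : is_bimodule_map f -> is_bimodule_map g ->
  (forall x : fd_car B i, moment (maps_mx g) (maps_mx f) i *m coB x = 0) ->
  moment (maps_mx g) (maps_mx f) i = 0.
Proof.
move=> bf bg; apply: (mulmx_coords_eq0 (vdim_le B i)).
exact: padded_r (padded_moment (maps_mx_padded bf) (maps_mx_padded bg) i).
Qed.

Lemma module_mx_rep : is_rep m module_mx.
Proof.
split=> [|i]; first exact: maps_mx_padded module_maps_bimod.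
apply: moment_eq0 => [||x]; try exact: module_maps_bimod.
rewrite -rel_compE; try exact: module_maps_bimod.
rewrite (_ : rel_comp _ _ _ = 0) ?raddf0 //.
exact: (lact_rel (fd_str B) x).
Qed.

Definition mx_of (h : forall i, fd_car B i -> fd_car B i) (H : 'I_n -> 'M[K]_N) :=
  vertex_fam m H /\ forall i x, coB (h i x) = H i *m coB x.

Lemma mx_of_linear (h : forall i, {linear fd_car B i -> fd_car B i}) :
  exists H, mx_of h H.
Proof.
pose H i : 'M[K]_N := \matrix_(s, t) coB (h i (of_coords (vdim_le B i) (delta_mx t 0))) s 0.
exists H; split=> [i|i x].
  apply: padded_entries => [s t|s t hs|s t ht]; rewrite mxE.
  - exact: (mxOverP (coords_kv _)).
  - by rewrite -coords_pid mul_pid_mxE [(s < _)%N]hs.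
  - have -> : of_coords (vdim_le B i) (delta_mx t 0) = 0.
      by apply: (coords_inj (vdim_le B i)); rewrite of_coords_delta ht raddf0.
    by rewrite !raddf0 mxE.
rewrite [in LHS](coords_expand (vdim_le B i) x) raddf_sum raddf_sum /=.
apply/colP=> s; rewrite summxE [RHS]mxE; apply: eq_bigr => t _.
rewrite linearZ coordsZ /= [LHS]mxE vsprojK ?(mxOverP (coords_over _ _)) //.
by rewrite mulrC [H i s t]mxE.
Qed.

Lemma linear_of_mx H : vertex_fam m H ->
  exists h : forall i, {linear fd_car B i -> fd_car B i}, mx_of h H.
Proof.
move=> gH.
have coh i (x : fd_car B i) : coB (of_coords (vdim_le B i) (H i *m coB x)) = H i *m coB x.
  rewrite of_coordsK // ?mulmxA ?(padded_l (gH i)) //.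
  by have h := mxOverM (padded_over (gH i)) (coords_kv x); exact: h.
have lh i : linear (fun x : fd_car B i => of_coords (vdim_le B i) (H i *m coB x)).
  move=> c x y; apply: (coords_inj (vdim_le B i)).
  rewrite coh [RHS]raddfD /= coordsZ !coh raddfD /= coordsZ mulmxDr -scalemxAr.
  by [].
by exists (fun i => linear_fun (lh i)).
Qed.

(* With f the module structure, the first side of [commutator_mx] says that g is
   the coboundary of h; with g = 0, that h is an endomorphism. *)
Section Commutator.
Variables (f g : arrow_maps) (h : forall i, fd_car B i -> fd_car B i) (H : 'I_n -> 'M[K]_N).
Hypotheses (bf : is_bimodule_map f) (bg : is_bimodule_map g) (hH : mx_of h H).

Lemma commutator_mxE i j (a : 'I_(narrows C i j)) x v :
  x \in pd_kap P (lcmd C i j) ->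
  coB (h (f (arrow_coef P x a) v) - f (arrow_coef P x a) (h v))
   = map_mx (sp_tr (sp_opp (mk_arrow a : sp_arrow S)))
      (x *: ((H j *m maps_mx f (mk_arrow a) - maps_mx f (mk_arrow a) *m H i) *m coB v)).
Proof.
move=> xE; rewrite raddfB /= hH.2 !maps_mxE // hH.2.
rewrite -(map_tr_mull (P := S)); last exact: padded_over (hH.1 j).
by rewrite -raddfB /= -scalemxAr -scalerBr mulmxBl !mulmxA.
Qed.

Lemma commutator_mx :
  (forall i j (e : arrow_bimod P i j) x, g e x = h (f e x) - f e (h x)) <->
  (forall a : sp_arrow S,
     maps_mx g a = H (sp_src (sp_opp a)) *m maps_mx f a - maps_mx f a *m H (sp_src a)).
Proof.
have gf := maps_mx_padded bf.
split=> [gE a|gE i j e x].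
  apply: maps_mx_eq => //.
    apply: paddedD; last apply: paddedN.
      by apply: paddedM (gf a); apply: padded_sub (sp_kv_tgt a) (hH.1 _).
    by apply: paddedM (gf a) _; apply: padded_sub (sp_kv_sub a) (hH.1 _).
  by case: a => i [j a] x v xE; rewrite gE commutator_mxE.
rewrite [e]arrow_bimodE !bm_suml //; apply: (coords_inj (vdim_le B j)).
rewrite raddfB /= hH.2 !raddf_sum -big_split; apply: eq_bigr => a _ /=.
by rewrite -hH.2 -raddfB /= commutator_mxE ?subvsP // maps_mxE ?subvsP // gE.
Qed.

End Commutator.

Lemma zero_bimod : is_bimodule_map (fun _ _ _ _ => 0 : fd_car B _).
Proof. by split=> *; rewrite ?addr0 ?scaler0. Qed.

Lemma brick_module_mx : brick B -> is_brick m module_mx.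
Proof.
move=> [[i0 [x0 x0n]] bB]; split.
  exists i0; apply: contra x0n; rewrite dimv_eq0 => /eqP f0.
  by have := memvf (x0 : fd_car B i0); rewrite f0 memv0.
move=> F [gF eF] [i Fi].
have [h hH] := linear_of_mx gF.
have hcomm : forall j l (e : arrow_bimod P j l) (x : lm_car B j),
    h l (lmact e x) = lmact (M := B) e (h j x).
  move=> j l e x; apply/eqP; rewrite -subr_eq0; apply/eqP.
  have [_ h0] := commutator_mx module_maps_bimod zero_bimod hH.
  symmetry; apply: h0 => a; rewrite eF subrr; apply: maps_mx_eq.
  - exact: zero_bimod.
  - exact: padded0.
  - by move=> *; rewrite mul0mx scaler0 !raddf0.
pose ff : lamHom B B := @LamHom _ _ _ _ P B B h hcomm.
have [|g gK] := bB ff.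
  exists i; apply: contrapT => h0; case/eqP: Fi.
  apply: (mulmx_coords_eq0 (vdim_le B i)); first exact: padded_r (gF i).
  move=> x; rewrite -hH.2; case: (eqVneq (h i x) 0) => [->|hx]; first exact: raddf0.
  by case: h0; exists x.
have [G [gG coG]] := mx_of_linear (fun i => g i : {linear fd_car B i -> fd_car B i}).
exists G; split=> // j; apply/eqP; rewrite -subr_eq0; apply/eqP.
apply: (mulmx_coords_eq0 (vdim_le B j)).
  by rewrite mulmxBl -mulmxA (padded_r (gG j)) pid_mx_idem.
move=> x; rewrite mulmxBl -mulmxA -coG -hH.2 coords_pid.
by have [_ /(_ x)] := gK j; rewrite /ff /= => ->; rewrite subrr.
Qed.

End HomMatrices.

(** * Rigidity in terms of matrices *)

(* The extension of B by itself defined by a cocycle xi: the module structure on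
   B + B acts by the triangular matrix with xi off the diagonal. *)
Section Deformation.
Variables (n : nat) (C : cartanDatum n) (k : fieldType).
Variables (K : splittingFieldType k) (P : preprojDatum C K) (B : fdLamModule P).
Local Notation kapv i := (subvs_of (pd_kap P (cd_d C i))).
Local Notation actB := (@module_maps _ _ _ _ P B).
Local Notation act := (@module_maps _ _ _ _ P B _ _).
Variable xi : arrow_maps B.
Hypothesis bxi : is_bimodule_map xi.
Hypothesis rxi : forall i (x : fd_car B i), rel_comp xi actB x + rel_comp actB xi x = 0.

Definition def_car (i : 'I_n) : lmodType (kapv i) := (fd_car B i * fd_car B i)%type.

Definition def_act i j (e : arrow_bimod P i j) (z : def_car i) : def_car j :=
  (act e z.1 + xi e z.2, act e z.2).

Fact def_actDl i j (e f : arrow_bimod P i j) z :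
  def_act (e + f) z = def_act e z + def_act f z.
Proof.
rewrite /def_act (bmDl (module_maps_bimod B)) (bmDl bxi) (bmDl (module_maps_bimod B)).
by congr (_, _); rewrite addrACA.
Qed.

Fact def_actDr i j (e : arrow_bimod P i j) y z :
  def_act e (y + z) = def_act e y + def_act e z.
Proof.
rewrite /def_act (bmDr (module_maps_bimod B)) (bmDr bxi) (bmDr (module_maps_bimod B)).
by congr (_, _); rewrite addrACA.
Qed.

Fact def_act_bal i j (e : arrow_bimod P i j) (c : kapv i) z :
  def_act (bimodr e c) z = def_act e (c *: z).
Proof. by rewrite /def_act !(bm_bal (module_maps_bimod B)) (bm_bal bxi). Qed.

Fact def_act_lin i j (c : kapv j) (e : arrow_bimod P i j) z :
  def_act (bimodl c e) z = c *: def_act e z.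
Proof.
rewrite /def_act !(bm_lin (module_maps_bimod B)) (bm_lin bxi).
by congr (_, _); rewrite /= scalerDr.
Qed.

Fact def_act_rel i (x : def_car i) :
  \sum_(j | j != i)
    (\sum_(a < narrows C i j) \sum_(p < size (pd_basis P j i))
      def_act (arrow_coef P (pd_dual P j i)`_p (pd_star P a))
        (def_act (arrow_coef P (pd_basis P j i)`_p a) x)) *~ pd_sgn P i j = 0.
Proof.
apply: injective_projections => /=; last first.
  rewrite (raddf_sum snd) -[RHS](lact_rel (fd_str B) x.2).
  apply: eq_bigr => j _; rewrite (raddfMz snd) (raddf_sum snd); congr (_ *~ _).
  by apply: eq_bigr => a _; rewrite (raddf_sum snd).
transitivity (rel_comp actB actB x.1 + (rel_comp xi actB x.2 + rel_comp actB xi x.2)).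
  rewrite /rel_comp -!big_split (raddf_sum fst) /=.
  apply: eq_bigr => j _; rewrite (raddfMz fst) (raddf_sum fst) -!mulrzDl; congr (_ *~ _).
  rewrite -!big_split; apply: eq_bigr => a _; rewrite (raddf_sum fst) -!big_split.
  apply: eq_bigr => p _ /=; rewrite (bmDr (module_maps_bimod B)).
  by rewrite [RHS]addrCA [in RHS]addrC -addrA; congr (_ + _); rewrite addrC.
rewrite rxi addr0; exact: (lact_rel (fd_str B) x.1).
Qed.

Definition def_mod : lamModule P :=
  LamModule (LamStruct def_actDl def_actDr def_act_bal def_act_lin def_act_rel).

Definition def_in_fun i (y : fd_car B i) : def_mod i := (y, 0).

Fact def_in_linear i : linear (@def_in_fun i).
Proof.
by move=> c y z; apply: injective_projections; rewrite /= ?scaler0 ?addr0.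
Qed.

Fact def_in_hom i j (e : arrow_bimod P i j) (y : fd_car B i) :
  linear_fun (@def_in_linear j) (lmact (M := B) e y)
    = lmact (M := def_mod) e (linear_fun (@def_in_linear i) y).
Proof.
apply: injective_projections => /=.
  by rewrite (bm0r bxi) addr0.
by rewrite (bm0r (module_maps_bimod B)).
Qed.

Definition def_in : lamHom B def_mod :=
  @LamHom _ _ _ _ P B def_mod (fun i => linear_fun (@def_in_linear i)) def_in_hom.

Definition def_out_fun i (z : def_mod i) : lm_car B i := z.2.

Fact def_out_linear i : linear (@def_out_fun i). Proof. by []. Qed.

Fact def_out_hom i j (e : arrow_bimod P i j) (z : def_mod i) :
  linear_fun (@def_out_linear j) (lmact (M := def_mod) e z)
    = lmact (M := B) e (linear_fun (@def_out_linear i) z).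
Proof. by []. Qed.

Definition def_out : lamHom def_mod B :=
  @LamHom _ _ _ _ P def_mod B (fun i => linear_fun (@def_out_linear i)) def_out_hom.

Fact def_in_inj i : injective (def_in i).
Proof. by move=> y z []. Qed.

Fact def_out_surj i (y : lm_car B i) : exists x, def_out i x = y.
Proof. by exists (0, y). Qed.

Fact def_exact i (x : def_mod i) :
  def_out i x = 0 <-> exists y, x = def_in i y.
Proof.
split=> [x20|[y ->]] //; exists x.1.
by apply: injective_projections.
Qed.

Definition def_ext : extension B B :=
  Extension def_in_inj def_out_surj def_exact.

(** A splitting sends (0, x) to (h x, x); comparing its effect before and after
    the action of e expresses xi through h. *)
Lemma def_split : ext_equiv def_ext (split_extension B B) ->
  exists h : forall i, {linear fd_car B i -> fd_car B i},
  forall i j (e : arrow_bimod P i j) x, xi e x = act e (h i x) - h j (act e x).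
Proof.
case=> f [fin fout].
pose h i (x : fd_car B i) : fd_car B i := (f i ((0, x) : def_mod i)).1.
have hl i : linear (h i).
  move=> c x y.
  rewrite /h -[c *: _ + _]/((c *: ((0, x) : def_mod i) + ((0, y) : def_mod i)).2).
  have -> : (0, (c *: ((0, x) : def_mod i) + ((0, y) : def_mod i)).2) =
    c *: ((0, x) : def_mod i) + ((0, y) : def_mod i).
    by apply: injective_projections => //=; rewrite scaler0 addr0.
  by rewrite linearP.
exists (fun i => linear_fun (hl i)) => i j e x.
have fE l (y z : fd_car B l) : f l ((y, z) : def_mod l) = (y + h l z, z).
  have -> : ((y, z) : def_mod l) = def_in l y + ((0, z) : def_mod l).
    by apply: injective_projections; rewrite /= ?addr0 ?add0r.
  rewrite raddfD /= fin.
  apply: injective_projections => /=; first by [].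
  by rewrite add0r; apply: (fout l (0, z)).
have /(congr1 fst) := lhomP f e ((0, x) : def_mod i).
rewrite [lmact e _]/(def_act _ _) /def_act /= (bm0r (module_maps_bimod B)) add0r.
rewrite !fE /= add0r => /(canRL (addrK _)) ->.
by [].
Qed.

End Deformation.

Section RigidTranslation.
Variables (n : nat) (C : cartanDatum n) (k : fieldType).
Variables (K : splittingFieldType k) (P : preprojDatum C K) (B : fdLamModule P).
Local Notation S := (pp_species P).
Local Notation N := (total_dim B).
Local Notation m := (vdim B).
Local Notation coB := (@coords _ _ _ N _).
Local Notation actB := (@module_maps _ _ _ _ P B).
Local Notation act := (@module_maps _ _ _ _ P B _ _).

Lemma rigid_module_mx : rigid B -> is_rigid m (module_mx B).
Proof.
move=> rB X [gX cX].
have bxi := mx_maps_bimod gX.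
have xiX : maps_mx (mx_maps (B := B) X) = X by apply/funext => a; apply: mx_mapsK.
have bact := module_maps_bimod B.
have rxi i (x : fd_car B i) : rel_comp (mx_maps X) actB x + rel_comp actB (mx_maps X) x = 0.
  apply: (coords_inj (vdim_le B i)); rewrite raddfD /= !rel_compE // xiX -mulmxDl addrC.
  by rewrite cX mul0mx raddf0.
have [h hE] := def_split (rB (def_ext bxi rxi)).
have [H [gH coH]] := mx_of_linear h.
have hH : mx_of (fun i x => - h i x) (fun i => - H i).
  by split=> [i|i x]; [apply: paddedN | rewrite raddfN /= coH mulNmx].
have [cm _] := commutator_mx bact bxi hH.
exists (fun i => - H i); split=> [i|a]; first exact: hH.1.
rewrite -[in LHS]xiX; apply: cm => i j e x.
by rewrite hE (bmNr bact) opprK addrC.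
Qed.

(* Conversely, choose linear sections of an extension E.  Their failure to
   commute with the action is a cocycle xi, and writing xi as a coboundary
   corrects the section into a module map. *)
Section Splitting.
Hypothesis rig : is_rigid m (module_mx B).
Variable E : extension B B.
Local Notation X := (ext_mid E).
Local Notation iota := (ext_in E).
Local Notation pi := (ext_out E).

Let lift (i : 'I_n) (t : 'I_(\dim {: fd_car B i})) : X i :=
  sval (cid (@ext_out_surj _ _ _ _ _ _ _ E i ((vbasis {: fd_car B i})`_t : lm_car B i))).

Let sec (i : 'I_n) (v : fd_car B i) : X i :=
  \sum_t coord (vbasis {: fd_car B i}) t v *: lift t.

Let secP i v : pi i (sec v) = v.
Proof.
rewrite /sec linear_sum [RHS](coord_vbasis (memvf (v : fd_car B i))).
by apply: eq_bigr => t _; rewrite linearZ /= /lift; case: cid => y /= ->.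
Qed.

Let sec_linear i : linear (@sec i).
Proof.
move=> c x y; rewrite /sec scaler_sumr -big_split; apply: eq_bigr => t _ /=.
by rewrite linearP scalerDl scalerA.
Qed.

Let ret i (z : X i) : fd_car B i :=
  if pselect (exists y, z = iota i y) is left h then sval (cid h) else 0.

Let retK i (z : X i) : pi i z = 0 -> iota i (ret z) = z.
Proof.
move=> /ext_exact h; rewrite /ret; case: pselect => // h'.
by case: cid => y /= ->.
Qed.

Let xi : arrow_maps B := fun i j e x => ret (lmact e (sec x) - sec (act e x)).

Let iota_xi i j (e : arrow_bimod P i j) (x : fd_car B i) :
  iota j (xi e x) = lmact e (sec x) - sec (act e x).
Proof.
apply: retK; rewrite raddfB /= secP lhomP secP.
exact: subrr.
Qed.

Let lin_sec i := linear_fun (@sec_linear i).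

Let xi_bimod : is_bimodule_map xi.
Proof.
have bact := module_maps_bimod B.
have secD i (x y : fd_car B i) : sec (x + y) = sec x + sec y by exact: (raddfD (lin_sec i)).
have secZ i c (x : fd_car B i) : sec (c *: x) = c *: sec x by exact: (linearZ_LR (lin_sec i)).
split=> [i j e f x|i j e x y|i j e c x|i j c e x];
  apply: (@ext_in_inj _ _ _ _ _ _ _ E j); rewrite ?raddfD ?linearZ /= !iota_xi.
- by rewrite (bmDl bact) secD /lmact lactDl opprD addrACA.
- by rewrite secD (bmDr bact) secD /lmact lactDr opprD addrACA.
- by rewrite (bm_bal bact) secZ /lmact lact_bal.
- by rewrite (bm_lin bact) secZ /lmact lact_lin scalerBr.
Qed.

Let xi_rel i (x : fd_car B i) : rel_comp actB xi x + rel_comp xi actB x = 0.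
Proof.
have bact := module_maps_bimod B.
have lact0 (M : lamModule P) a b (e : arrow_bimod P a b) : lmact e (0 : M a) = 0.
  by apply: (addIr (lmact e 0)); rewrite /lmact -lactDr !add0r.
have lactB (M : lamModule P) a b (e : arrow_bimod P a b) (y z : M a) :
    lmact e (y - z) = lmact e y - lmact e z.
  by apply: (addIr (lmact e z)); rewrite /lmact -lactDr !subrK.
apply: (@ext_in_inj _ _ _ _ _ _ _ E i); rewrite raddf0.
have h1 := lact_rel (lm_str X) (sec x).
have [ls lsE] : exists ls : {linear fd_car B i -> X i}, forall y, ls y = sec y.
  by exists (lin_sec i).
have h2 : ls (rel_comp actB actB x) = 0.
  rewrite [rel_comp _ _ _](_ : _ = 0) ?raddf0 //; exact: (lact_rel (fd_str B) x).
rewrite -[RHS]h1 -[RHS]subr0 -[X in _ = _ - X]h2 /rel_comp -big_split /=.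
rewrite !raddf_sum -big_split; apply: eq_bigr => j _ /=.
rewrite -mulrzDl !raddfMz -mulrzDl; congr (_ *~ _).
rewrite -big_split /= !raddf_sum -big_split; apply: eq_bigr => a _ /=.
rewrite -big_split /= !raddf_sum -big_split; apply: eq_bigr => p _ /=.
rewrite lsE.
rewrite raddfD /= iota_xi [iota i _](lhomP (ext_in E)) iota_xi lactB.
by rewrite addrA subrK.
Qed.

Lemma module_mx_split : ext_equiv E (split_extension B B).
Proof.
have bact := module_maps_bimod B.
have cxi : is_cocycle m (module_mx B) (maps_mx xi).
  split=> [|i]; first exact: maps_mx_padded xi_bimod.
  have gm := paddedD (padded_moment (maps_mx_padded xi_bimod) (maps_mx_padded bact) i)
                   (padded_moment (maps_mx_padded bact) (maps_mx_padded xi_bimod) i).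
  apply: (mulmx_coords_eq0 (vdim_le B i)); first exact: padded_r gm.
  move=> x; rewrite mulmxDl -!rel_compE //; try exact: xi_bimod.
  by rewrite -raddfD /= xi_rel raddf0.
have [F [gF FE]] := rig cxi.
have [h hF] := linear_of_mx gF.
have [_ cm] := commutator_mx bact xi_bimod hF.
have xiE := cm FE.
pose s i (x : fd_car B i) : X i := sec x + iota i (h i x).
have slin i : linear (@s i).
  move=> c x y; rewrite /s (sec_linear c x y) !linearP /= scalerDr.
  by rewrite addrACA.
have piota i (y : fd_car B i) : pi i (iota i y) = 0 by apply/ext_exact; exists y.
have sP i x : pi i (@s i x) = x by rewrite /s raddfD /= secP piota addr0.
have sact i j (e : arrow_bimod P i j) x : s j (act e x) = lmact e (s i x).
  have lactD (y z : X i) : lmact e (y + z) = lmact e y + lmact e z.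
    exact: lactDr.
  rewrite /s lactD -[lmact e (iota i _)](lhomP (ext_in E)).
  rewrite [lmact e (sec x)](_ : _ = iota j (xi e x) + sec (act e x)); last first.
    by rewrite iota_xi subrK.
  rewrite addrAC addrC; congr (_ + _); rewrite -raddfD xiE /=.
  by congr (iota j _); rewrite subrK.
pose f i (z : X i) : dsum B B i := (ret (z - s i (pi i z)), pi i z).
have pf i (z : X i) : pi i (z - s i (pi i z)) = 0.
  by rewrite raddfB /= sP subrr.
have iota1 i (z : X i) : iota i (f i z).1 = z - s i (pi i z).
  exact: retK.
have flin i : linear (f i).
  move=> c y z; apply: injective_projections => /=; last by rewrite linearP.
  apply: (@ext_in_inj _ _ _ _ _ _ _ E i); rewrite retK // [RHS]linearP /= !retK //.
  by rewrite [pi i _]linearP /= slin scalerBr opprD addrACA.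
have fhom i j (e : arrow_bimod P i j) (z : X i) :
    linear_fun (flin j) (lmact e z) = lmact (M := dsum B B) e (linear_fun (flin i) z).
  apply: injective_projections => /=; last exact: (lhomP (ext_out E)).
  apply: (@ext_in_inj _ _ _ _ _ _ _ E j); rewrite retK // (lhomP (ext_in E)) /= retK //.
  rewrite (lhomP (ext_out E)) -[s j _]/(s j (act e (pi i z))) sact.
  by apply: (addIr (lmact e (s i (pi i z)))); rewrite /lmact -lactDr !subrK.
exists (@LamHom _ _ _ _ P X (dsum B B) (fun i => linear_fun (flin i)) fhom).
split=> i y //=; apply: injective_projections => /=; last exact: piota.
apply: (@ext_in_inj _ _ _ _ _ _ _ E i); rewrite retK //.
have s0 : @s i 0 = 0 by exact: (raddf0 (linear_fun (slin i))).
by rewrite piota s0 subr0.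
Qed.

End Splitting.

Lemma module_mx_rigid : is_rigid m (module_mx B) -> rigid B.
Proof. by move=> rig E; apply: module_mx_split. Qed.

End RigidTranslation.

(** * Roots and the bilinear form *)
Section Roots.
Variables (R : realType) (n : nat) (C : cartanDatum n).
Implicit Types (x y z : 'rV[R]_n) (m : 'I_n -> nat).
Local Notation d := (cd_d C).
Local Notation A := (cd_A C).

Lemma cformC x y : cform C x y = cform C y x.
Proof.
rewrite /cform exchange_big; apply: eq_bigr => j _; apply: eq_bigr => i _ /=.
by rewrite cd_sym [x 0 i * _]mulrC.
Qed.

Lemma cformBl x z y : cform C (x - z) y = cform C x y - cform C z y.
Proof.
rewrite /cform -sumrB; apply: eq_bigr => i _; rewrite -sumrB.
by apply: eq_bigr => j _; rewrite !mxE !mulrBl.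
Qed.

Lemma cformZl c x y : cform C (c *: x) y = c * cform C x y.
Proof.
rewrite /cform mulr_sumr; apply: eq_bigr => i _; rewrite mulr_sumr.
by apply: eq_bigr => j _; rewrite !mxE !mulrA.
Qed.

Lemma cformBr x y z : cform C x (y - z) = cform C x y - cform C x z.
Proof. by rewrite cformC cformBl !(cformC _ x). Qed.

Lemma cformZr c x y : cform C x (c *: y) = c * cform C x y.
Proof. by rewrite cformC cformZl cformC. Qed.

Lemma d_neq0 i : (d i)%:R != 0 :> R.
Proof. by rewrite pnatr_eq0 -lt0n cd_d_gt0. Qed.

Lemma cform_coroot i x : cform C (scoroot R C i) x = \sum_j (A i j)%:~R * x 0 j.
Proof.
rewrite cformZl /cform (bigD1 i) //= [X in _ + X]big1 ?addr0 => [|l li]; last first.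
  by rewrite big1 // => j _; rewrite mxE (negPf li) andbF !mul0r.
rewrite mulr_sumr; apply: eq_bigr => j _; rewrite mxE !eqxx mul1r intrM.
by rewrite -pmulrn mulrCA mulKf ?d_neq0 // mulrC.
Qed.

Lemma cform_sroot i x : cform C (sroot R i) x = (d i)%:R * cform C (scoroot R C i) x.
Proof. by rewrite cformZl mulrA mulfV ?d_neq0 // mul1r. Qed.

Lemma coroot_root i : cform C (scoroot R C i) (sroot R i) = 2.
Proof.
rewrite cform_coroot (bigD1 i) //= big1 ?addr0 => [|j ji].
  by rewrite mxE !eqxx mulr1 cd_diag.
by rewrite mxE (negPf ji) andbF mulr0.
Qed.

Lemma cform_srefl i x y : cform C (srefl C i x) (srefl C i y) = cform C x y.
Proof.
rewrite /srefl; set a := cform _ _ x; set b := cform _ _ y.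
rewrite cformBl !cformBr !cformZl !cformZr.
rewrite [cform C x (sroot R i)]cformC !cform_sroot coroot_root -/a -/b; ring.
Qed.

Lemma sreflK i : involutive (@srefl R n C i).
Proof.
move=> x; rewrite /srefl; set a := cform _ _ x.
rewrite cformBr cformZr -/a coroot_root.
by rewrite (_ : a - a * 2 = - a); [rewrite scaleNr opprK subrK | ring].
Qed.

(** Injectivity is carried along to know that [w^-1] is a two-sided inverse. *)
Lemma weyl_isometry w : weyl C w ->
  (forall x y, cform C (w x) (w y) = cform C x y) /\ lker w == 0%VS.
Proof.
elim=> {w} [|i|u w _ [fu ku] _ [fw kw]|w _ [fw kw]].
- split=> [x y|]; first by rewrite !id_lfunE.
  by apply/lker0P => x y; rewrite !id_lfunE.
- split=> [x y|]; first by rewrite !lfunE cform_srefl.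
  apply/lker0P => x y; rewrite !lfunE; exact: (can_inj (sreflK i)).
- split=> [x y|]; first by rewrite !comp_lfunE fu fw.
  by apply/lker0P => x y; rewrite !comp_lfunE => /(lker0P ku)/(lker0P kw).
have wK : cancel w (w^-1)%VF by apply: lker0_lfunK.
have wK' : cancel (w^-1)%VF w.
  move=> x; apply: limg_lfunVK.
  have : (limg w == fullv)%VS.
    by rewrite eqEdim subvf limg_dim_eq /= ?leqnn // capfv; apply/eqP.
  by move/eqP->; apply: memvf.
split=> [x y|]; first by rewrite -fw !wK'.
by apply/lker0P; apply: can_inj wK'.
Qed.

Lemma real_root_form_gt0 x : real_root C x -> 0 < cform C x x.
Proof.
case=> w [Ww [i ->]]; rewrite (weyl_isometry Ww).1 cform_sroot coroot_root.
by rewrite mulr_gt0 ?ltr0n ?cd_d_gt0.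
Qed.

Lemma real_root_srefl i x : real_root C (srefl C i x) -> real_root C x.
Proof.
case=> w [Ww [j wj]]; exists (linfun (@srefl R n C i) \o w)%VF; split.
  by apply: weyl_mul => //; apply: weyl_srefl.
by exists j; rewrite comp_lfunE lfunE /= -wj sreflK.
Qed.

Lemma real_root_simple i : real_root C (sroot R i).
Proof. by exists \1%VF; split; [apply: weyl_one | exists i; rewrite id_lfunE]. Qed.

(** The division defining [narrows] is exact: d_i A_ij = d_j A_ji is divisible by
    both d_i and d_j. *)
Lemma narrows_lcmd i j : i != j ->
  (narrows C i j * lcmd C i j = d i * `|A i j|)%N.
Proof.
move=> ij; rewrite /narrows (negPf ij) abszN divnK; first by rewrite abszM.
rewrite /lcmd dvdn_lcm abszM dvdn_mulr //=.
by have := congr1 absz (cd_sym C i j); rewrite !abszM => ->; rewrite dvdn_mulr.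
Qed.

Definition dim_row m : 'rV[R]_n := \row_j (m j)%:R.

Variables (k : fieldType) (K : splittingFieldType k) (P : preprojDatum C K).
Local Notation S := (pp_species P).

Lemma narrows_rk i j : i != j -> (narrows C i j * size (pd_basis P i j) = `|A i j|)%N.
Proof.
move=> ij; apply/eqP; rewrite -(eqn_pmul2l (cd_d_gt0 C i)) -narrows_lcmd //.
case E: (narrows C i j) => [|q]; first by rewrite mul0n muln0.
have a : 'I_(narrows C i j) by rewrite E; apply: ord0.
have := sp_dim (mk_arrow a : sp_arrow S); rewrite /= /pp_ka /pp_kv /pp_src /pp_tgt /=.
rewrite !pd_dim_kap ?lcmd_dvd ?d_dvd_lcm_all // => ->.
by rewrite /pp_eb /pp_src /pp_tgt /= mulnCA [(d i * _)%N]mulnC.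
Qed.

(** The field on an arrow i -> j has degree d_ij / d_i over that of i, so each
    coordinate at j contributes - A_ij to the dimension of M~_i. *)
Lemma nbr_dimE m i :
  (nbr_dim S m i)%:R = - \sum_(j | j != i) (A i j)%:~R * (m j)%:R :> R.
Proof.
rewrite /nbr_dim sum_arrows_at natr_sum -sumrN; apply: eq_bigr => j ji.
rewrite (eq_bigr (fun=> size (pd_basis P i j) * m j)%N) //.
rewrite sum_nat_const card_ord mulnA narrows_rk 1?eq_sym // natrM -mulNr.
congr (_ * _); rewrite -mulrNz pmulrn; congr (_ %:~R).
by have := cd_offdiag C (i := i) (j := j); rewrite eq_sym => /(_ ji) /lez0_abs.
Qed.

Lemma coroot_dim_row m i :
  cform C (scoroot R C i) (dim_row m) = (2 * m i)%:R - (nbr_dim S m i)%:R.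
Proof.
rewrite cform_coroot nbr_dimE opprK (bigD1 i) //= cd_diag mxE natrM.
by congr (_ + _); apply: eq_bigr => j _; rewrite mxE.
Qed.

Lemma form_dim_row m : cform C (dim_row m) (dim_row m)
  = \sum_i (d i * m i)%:R * ((2 * m i)%:R - (nbr_dim S m i)%:R).
Proof.
rewrite {1}/cform; apply: eq_bigr => i _; rewrite -coroot_dim_row cform_coroot.
rewrite mulr_sumr; apply: eq_bigr => j _; rewrite mxE intrM natrM -pmulrn; ring.
Qed.

(** A vector with nonnegative coordinates and positive norm pairs positively with
    some simple root. *)
Lemma form_pos_small m : 0 < cform C (dim_row m) (dim_row m) ->
  exists i, (nbr_dim S m i < 2 * m i)%N.
Proof.
move=> pos; apply: contrapT => h; move: pos; rewrite ltNge form_dim_row.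
case/negP; apply: sumr_le0 => i _; apply: mulr_ge0_le0; first exact: ler0n.
by rewrite subr_le0 ler_nat leqNgt; apply/negP => hi; apply: h; exists i.
Qed.

Lemma srefl_dim_row m m' i : (forall j, j != i -> m' j = m j) ->
  (m' i + m i)%N = nbr_dim S m i -> dim_row m' = srefl C i (dim_row m).
Proof.
move=> mm mi; apply/rowP=> j; rewrite /srefl coroot_dim_row -mi !mxE.
case: (eqVneq j i) => [->|ji]; last by rewrite andbF mulr0 subr0 mm.
by rewrite !eqxx mulr1 natrM natrD; ring.
Qed.

(** [rigid_dim] bounds the number of arrow entries by twice that of vertex
    entries; grouping the arrows by source turns this into positivity of the
    norm. *)
Lemma rigid_form_pos (N : nat) m (Q : sp_arrow S -> 'M[K]_N) :
  (forall j, (m j <= N)%N) -> arrow_fam m Q -> is_rigid m Q ->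
  (exists i, m i != 0%N) -> 0 < cform C (dim_row m) (dim_row m).
Proof.
move=> mN gQ rQ nz; have := rigid_dim mN gQ rQ nz.
have kvd i : \dim (sp_kv S i) = d i by apply: (pd_dim_kap P); apply: d_dvd_lcm_all.
rewrite (partition_big (@sp_src _ _ _ S) predT) //= => lt.
rewrite form_dim_row; under eq_bigr => i _ do rewrite mulrBr -!natrM.
rewrite sumrB subr_gt0 -!natr_sum ltr_nat.
apply: leq_ltn_trans (leq_trans lt _); last first.
  rewrite big_distrr /=; apply: leq_sum => i _; rewrite kvd.
  nia.
apply: leq_sum => i _; rewrite big_distrr /=; apply: leq_sum => a /eqP sa.
have := @sp_dim _ _ _ S a; rewrite kvd.
change (sp_src (a : sp_arrow S)) with (pp_src a); rewrite sa => da.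
change (\dim (pp_ka P a)) with (\dim (sp_ka (a : sp_arrow S))); rewrite da /=; nia.
Qed.

End Roots.

Theorem proposition4p14 (R : realType) (n : nat) (C : cartanDatum n)
    (k : fieldType) (K : splittingFieldType k) (P : preprojDatum C K)
    (B : fdLamModule P) (hB : brick B) :
  [<-> real_root C (dimvec R B);
       0 < cform C (dimvec R B) (dimvec R B);
       rigid B].
Proof.
have -> : dimvec R B = dim_row R (vdim B).
  apply/rowP=> j; rewrite /dimvec summxE mxE (bigD1 j) //= !mxE !eqxx mulr1.
  by rewrite big1 ?addr0 // => i ij; rewrite !mxE eq_sym (negPf ij) andbF mulr0.
have bQ := brick_module_mx hB.
have main : 0 < cform C (dim_row R (vdim B)) (dim_row R (vdim B)) ->
    real_root C (dim_row R (vdim B)) /\ is_rigid (vdim B) (module_mx B).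
  move=> pos; apply: (@brick_induction _ _ _ (pp_species P) (total_dim B)
    (fun m => 0 < cform C (dim_row R m) (dim_row R m))
    (fun m => real_root C (dim_row R m)) _ _ _ _ (vdim B) (module_mx B)) pos.
  - by move=> m; apply: form_pos_small.
  - by move=> i m m' mm mi; rewrite (srefl_dim_row R mm mi) cform_srefl.
  - by move=> i m m' mm mi; rewrite (srefl_dim_row R mm mi); apply: real_root_srefl.
  - move=> i m m1; rewrite (_ : dim_row R m = sroot R i); first exact: real_root_simple.
    by apply/rowP=> j; rewrite !mxE m1.
  - exact: vdim_le.
  - exact: module_mx_rep.
  - exact: bQ.
tfae.
- exact: real_root_form_gt0.
- by case/main => _ /module_mx_rigid.
- move=> /rigid_module_mx rB; apply: (main _).1.
  exact: rigid_form_pos (vdim_le B) (module_mx_rep B).1 rB bQ.1.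
Qed.
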